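(* For every integer $q\geq 2$, writing $\mathbf{S}_p:=\sum_{n\ge1}\frac{\binom{2n}{n}}{4^nn^p}$, $\mathbf{S}_{2,p}:=\sum_{n\ge1}\frac{H_n^{(2)}\binom{2n}{n}}{4^nn^p}$, $\mathbf{S}_{1^2,p}:=\sum_{n\ge1}\frac{H_n^2\binom{2n}{n}}{4^nn^p}$ and $\tilde{\mathbf{S}}_p:=\sum_{n\ge1}\frac{4^n}{n^p\binom{2n}{n}}$, we have \begin{align*} \sum_{n=1}^{\infty}\frac{4^nH_n}{n^q\binom{2n}{n}} &=\tilde{\mathbf{S}}_{q+1}+\frac{(-1)^q}{2}\{\mathbf{S}_{1^2,q-1}-\zeta(2)\mathbf{S}_{q-1}+\mathbf{S}_{2,q-1}\}\\ &\quad+\frac{1}{2}\sum_{k_1+\cdots+k_5=q-1}G(k_1,k_2,k_3,k_4)(k_5+1)\zeta(k_5+2) -\frac{1}{2}\sum_{k_1+\cdots+k_6=q-3}G(k_1,k_2,k_3,k_4)\zeta(k_5+2)\zeta(k_6+2)\,, \end{align*} and \begin{align*} \sum_{n=1}^{\infty}\frac{4^nH_{2n}}{n^q\binom{2n}{n}} &=\left(1-\frac{q}{2}\right)\tilde{\mathbf{S}}_{q+1}+\ln(2)\tilde{\mathbf{S}}_q +\frac{(-1)^q}{2}\{\mathbf{S}_{1^2,q-1}-2\zeta(2)\mathbf{S}_{q-1}+2\mathbf{S}_{2,q-1}\}\\ &\quad+\sum_{k_1+\cdots+k_5=q-1}G(k_1,k_2,k_3,k_4)(k_5+1)\zeta(k_5+2)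 -\frac{1}{2}\sum_{k_1+\cdots+k_6=q-3}G(k_1,k_2,k_3,k_4)\zeta(k_5+2)\zeta(k_6+2)\,, \end{align*} where all $k_i$ range over nonnegative integers (an empty sum is $0$).
   Context: $H_n^{(s)}=\sum_{k=1}^nk^{-s}$, $H_n=H_n^{(1)}$. $G(k_1,k_2,k_3,k_4):=\frac{2^{k_3+k_4}\ln^{k_4}(2)\,C_{k_1}C_{k_2}D_{k_3}}{k_1!k_2!k_3!k_4!}$, where, with the exponential complete Bell polynomials $Y_n$ defined by $\exp\left(\sum_{k\geq1}x_k\frac{t^k}{k!}\right)=\sum_{n\geq0}Y_n(x_1,\ldots,x_n)\frac{t^n}{n!}$, $C_n=Y_n(x_1,\dots,x_n)$ with $x_1=0$, $x_j=(-1)^j(j-1)!\zeta(j)$ ($j\ge2$), and $D_n=Y_n(x_1,\dots,x_n)$ with $x_1=0$, $x_j=(-1)^{j-1}(j-1)!\zeta(j)$ ($j\ge2$). *)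

(* Defs.v *)
From mathcomp Require Import all_boot all_order all_algebra.
From mathcomp Require Import all_classical all_reals all_analysis.

Set Implicit Arguments.
Unset Strict Implicit.
Unset Printing Implicit Defensive.

Import Order.TTheory GRing.Theory Num.Theory.
Import numFieldNormedType.Exports.

Local Open Scope classical_set_scope.
Local Open Scope ring_scope.

Section Definitions.
Context {R : realType}.
Implicit Types (u x : nat -> R) (l : R) (s n p : nat).

(* Series are indexed by n >= 1. [sum_ge1 u] is a total operator, meaningful
   when the series converges; [sums_to u l] also asserts convergence. *)
Definition sum_ge1 u : R := limn (fun N => \sum_(1 <= n < N) u n).

Definition sums_to u l : Prop :=
  (fun N => \sum_(1 <= n < N) u n) @ \oo --> l.

Definition zeta s : R := sum_ge1 (fun n => (n%:R ^+ s)^-1).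

Definition harm s n : R := \sum_(1 <= k < n.+1) (k%:R ^+ s)^-1.

(* Y_n(x_1, ..., x_n) is n! times the coefficient of t^n in the formal power
   series exp(\sum_(k >= 1) x_k t^k / k!). The exponent has no constant term, so
   truncating it at degree n, and the exponential series at its n-th power,
   leaves that coefficient unchanged. The value x 0 is not used. *)
Definition bellY x n : R :=
  n`!%:R *
  (\sum_(0 <= m < n.+1)
     (m`!%:R)^-1 *: (\sum_(1 <= k < n.+1) (x k / k`!%:R) *: 'X^k) ^+ m)`_n.

Definition coefC n : R :=
  bellY (fun j => if j == 1%N then 0
                  else (-1) ^+ j * (j.-1)`!%:R * zeta j) n.

Definition coefD n : R :=
  bellY (fun j => if j == 1%N then 0
                  else (-1) ^+ j.-1 * (j.-1)`!%:R * zeta j) n.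

Definition coefG (k1 k2 k3 k4 : nat) : R :=
  2 ^+ (k3 + k4) * ln 2 ^+ k4 * coefC k1 * coefC k2 * coefD k3
  / (k1`! * k2`! * k3`! * k4`!)%N%:R.

Definition binom_ratio n : R := 'C(2 * n, n)%:R / 4 ^+ n.

Definition S_ p : R := sum_ge1 (fun n => binom_ratio n / n%:R ^+ p).

Definition S_2 p : R :=
  sum_ge1 (fun n => harm 2 n * binom_ratio n / n%:R ^+ p).

Definition S_11 p : R :=
  sum_ge1 (fun n => harm 1 n ^+ 2 * binom_ratio n / n%:R ^+ p).

Definition S_tilde p : R :=
  sum_ge1 (fun n => 4 ^+ n / (n%:R ^+ p * 'C(2 * n, n)%:R)).

(* Sums over k_1 + ... + k_5 = q - 1 and k_1 + ... + k_6 = q - 3. The index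
   conditions are written without subtraction, so that the second sum is empty
   for q = 2; they force every k_i < q, so the bounds lose no term. *)
Definition sumG_linear q : R :=
  \sum_(k1 < q) \sum_(k2 < q) \sum_(k3 < q) \sum_(k4 < q)
    \sum_(k5 < q | (k1 + k2 + k3 + k4 + k5 + 1 == q)%N)
      coefG k1 k2 k3 k4 * (k5 + 1)%N%:R * zeta (k5 + 2).

Definition sumG_quadratic q : R :=
  \sum_(k1 < q) \sum_(k2 < q) \sum_(k3 < q) \sum_(k4 < q) \sum_(k5 < q)
    \sum_(k6 < q | (k1 + k2 + k3 + k4 + k5 + k6 + 3 == q)%N)
      coefG k1 k2 k3 k4 * zeta (k5 + 2) * zeta (k6 + 2).

End Definitions.

Arguments zeta R s : clear implicits.
Arguments harm R s n : clear implicits.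
Arguments S_ R p : clear implicits.
Arguments S_2 R p : clear implicits.
Arguments S_11 R p : clear implicits.
Arguments S_tilde R p : clear implicits.
Arguments sumG_linear R q : clear implicits.
Arguments sumG_quadratic R q : clear implicits.

(* Main.v *)
(* Let b_n = binom(2n,n) / 4^n and f(x) = 1 + \sum_(m >= 1) b_m x / (m + x),
   which is x B(x, 1/2). At an integer, f(n) = 1 / b_n = 4^n / binom(2n,n), so
   each of the two series is a double series in (n, m); summing it over n first
   and splitting 1 / (n^p (n + m)) into partial fractions leaves Euler sums
   \sum H_{n-1} / n^p (expressed by products of zeta values) and the sums
   \sum b_m m^-p (..). The weights of the former are the numbers
   (-1)^(i-1) S_i, the Taylor coefficients of f at 0. They agree with the
   convolutions of G because f = \prod_j (1 + x / (j - 1/2)) / (1 + x / j): both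
   power series have logarithmic derivative
   2 ln 2 + \sum_i (-1)^i (2^(i+1) - 2) zeta(i+1) x^i. For H_{2n} one also
   expands f'(n) = f(n) (2 H_n - 2 H_{2n} + 2 ln 2). *)

From mathcomp Require Import all_boot all_order all_algebra.
From mathcomp Require Import all_classical all_reals all_analysis.
From mathcomp Require Import ring lra zify.
Require Import Defs.

Import Order.TTheory GRing.Theory Num.Theory.
Import numFieldNormedType.Exports.

Local Open Scope ring_scope.

(** No analysis of f as a function of a real variable takes place: f enters only through its Taylor
    coefficients at the natural numbers N, and apart from the constant term f(N) these are, up to
    sign, series with nonnegative terms. The equation (x + 1/2) f(x + 1) = (x + 1) f(x) becomes a
    recurrence from the coefficients at N to those at N + 1, proved by telescoping in m. Iterated,
    it reads f(t) = P_N(t) b_N f(N + t) with P_N a finite product, and b_N f(N + t) tends to 1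
    coefficientwise, so the product for f is a limit taken at each fixed degree, modulo a power of
    X. The weights G are no accident: with Euler's constant g, the series of C_n / n! is e^(g t)
    Gamma(1 + t) and that of D_n / n! is its inverse, so C(t)^2 D(2t) 4^t = 4^t Gamma(1 + t)^2 /
    Gamma(1 + 2t), where g has cancelled; this interpolates 4^n / binom(2n,n). The obstacle to
    convergence is that b_n decays only like n^(-1/2), so for q = 2 the sums in m are slow. All
    double series are arranged to have nonnegative terms (with H_{n-1}, or with minus a derivative
    in n), which makes the exchange of summations a matter of monotone convergence. *)

Ltac nonzero := repeat (apply/andP; split);
  solve [assumption | apply: lt0r_neq0; lra].

(** * Series with nonnegative terms, comparison and exchange of summations *)

Section SumsTo.
Set Implicit Arguments.
Unset Strict Implicit.
Context {R : realType}.
Implicit Types (u v : nat -> R) (l : R).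
Local Open Scope classical_set_scope.

Lemma eq_sums_to u v l :
  (forall n, (0 < n)%N -> u n = v n) -> sums_to u l -> sums_to v l.
Proof.
move=> uv; rewrite /sums_to; apply: cvg_trans; apply: near_eq_cvg.
by near=> N; apply: eq_big_nat => i /andP[i0 _]; rewrite uv.
Unshelve. all: by end_near. Qed.

Lemma sums_to_uniq u l l' : sums_to u l -> sums_to u l' -> l = l'.
Proof. exact: (@cvg_unique _ (@norm_hausdorff _ R)). Qed.

Lemma sum_ge1E u l : sums_to u l -> sum_ge1 u = l.
Proof. by move=> ul; apply: (cvg_lim (@norm_hausdorff _ R)). Qed.

Lemma sums_toD u v l l' :
  sums_to u l -> sums_to v l' -> sums_to (fun n => u n + v n) (l + l').
Proof.
move=> ul vl; rewrite /sums_to; under eq_fun do rewrite big_split /=.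
exact: cvgD.
Qed.

Lemma sums_toZ c u l : sums_to u l -> sums_to (fun n => c * u n) (c * l).
Proof.
move=> ul; rewrite /sums_to; under eq_fun do rewrite -mulr_sumr.
exact: cvgMl_tmp.
Qed.

Lemma sums_toN u l : sums_to u l -> sums_to (fun n => - u n) (- l).
Proof.
move=> ul; rewrite /sums_to; under eq_fun do rewrite sumrN.
exact: cvgN.
Qed.

Lemma sums_toB u v l l' :
  sums_to u l -> sums_to v l' -> sums_to (fun n => u n - v n) (l - l').
Proof. by move=> ul vl; apply: sums_toD => //; apply: sums_toN. Qed.

Lemma sums_to0 : sums_to (fun _ => 0 : R) 0.
Proof.
rewrite /sums_to; under eq_fun do rewrite big1 //.
exact: cvg_cst.
Qed.

Lemma sums_to_sum (I : Type) (s : seq I) (P : pred I) (u : I -> nat -> R) (l : I -> R) :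
  (forall i, P i -> sums_to (u i) (l i)) ->
  sums_to (fun n => \sum_(i <- s | P i) u i n) (\sum_(i <- s | P i) l i).
Proof.
move=> ul; elim: s => [|i s IH].
  by rewrite big_nil; apply: eq_sums_to sums_to0 => n _; rewrite big_nil.
rewrite big_cons; case: ifPn => Pi.
  apply: (eq_sums_to _ (sums_toD (ul i Pi) IH)) => n _.
  by rewrite big_cons Pi.
by apply: eq_sums_to IH => n _; rewrite big_cons (negbTE Pi).
Qed.

Lemma le_sums_to u v l l' : sums_to u l -> sums_to v l' ->
  (forall n, (0 < n)%N -> u n <= v n) -> l <= l'.
Proof.
move=> ul vl uv; apply: (ler_cvg_to ul vl); near=> N.
by apply: ler_sum_nat => i /andP[i0 _]; apply: uv.
Unshelve. all: by end_near. Qed.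

Lemma sum_ge1_nd u : (forall n, (0 < n)%N -> 0 <= u n) ->
  nondecreasing_seq (fun N => \sum_(1 <= n < N) u n).
Proof.
move=> u0; apply/nondecreasing_seqP => -[|N]; first by rewrite !big_geq.
by rewrite [leRHS]big_nat_recr //= lerDl u0.
Qed.

Lemma sums_to_bounded u M : (forall n, (0 < n)%N -> 0 <= u n) ->
  (forall N, \sum_(1 <= n < N) u n <= M) ->
  sums_to u (sum_ge1 u) /\ sum_ge1 u <= M.
Proof.
move=> u0 uM; have cu : cvgn (fun N => \sum_(1 <= n < N) u n).
  apply: nondecreasing_is_cvgn; first exact: sum_ge1_nd.
  by exists M => _ [N _ <-].
by split=> //; apply: limr_le => //; near=> N.
Unshelve. all: by end_near. Qed.

Lemma sums_to_ge_partial u l N : (forall n, (0 < n)%N -> 0 <= u n) ->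
  sums_to u l -> \sum_(1 <= n < N) u n <= l.
Proof.
move=> u0 ul; rewrite -(sum_ge1E ul).
by apply: (nondecreasing_cvgn_le (sum_ge1_nd u0)); apply/cvg_ex; exists l.
Qed.

Lemma sums_to_le u v l : (forall n, (0 < n)%N -> 0 <= u n <= v n) ->
  sums_to v l -> sums_to u (sum_ge1 u).
Proof.
move=> uv vl; have u0 n : (0 < n)%N -> 0 <= u n by move=> /uv/andP[].
have v0 n : (0 < n)%N -> 0 <= v n.
  by move=> /uv/andP[]; apply: le_trans.
apply: (@sums_to_bounded u l u0 _).1 => N.
apply: le_trans (sums_to_ge_partial N v0 vl).
by apply: ler_sum_nat => i /andP[/uv/andP[]].
Qed.

Lemma sums_to_telescope u v : (forall n, (0 < n)%N -> u n = v n - v n.+1) ->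
  v @ \oo --> 0 -> sums_to u (v 1%N).
Proof.
move=> uv v0; rewrite /sums_to -[X in _ --> X]subr0.
rewrite -cvg_shiftS /=.
have -> : (fun N => \sum_(1 <= n < N.+1) u n) = (fun N => v 1%N - v N.+1).
  apply/funext => N; elim: N => [|N IH]; first by rewrite big_geq // subrr.
  by rewrite big_nat_recr //= IH uv //; lra.
apply: cvgB; first exact: cvg_cst.
by rewrite (cvg_shiftS v).
Qed.

(** A finite sum of columns is again a series over the row index, dominated termwise by the row
    sums. Hence [S] bounds every partial sum of [c], and monotone convergence gives both
    conclusions. *)
Lemma sums_to_swap_le (a : nat -> nat -> R) r S c :
  (forall i j, (0 < i)%N -> (0 < j)%N -> 0 <= a i j) ->
  (forall i, (0 < i)%N -> sums_to (a i) (r i)) -> sums_to r S ->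
  (forall j, (0 < j)%N -> sums_to (a ^~ j) (c j)) ->
  sums_to c (sum_ge1 c) /\ sum_ge1 c <= S.
Proof.
move=> a0 ar rS ac; apply: sums_to_bounded => [j j0|J].
  by apply: (le_sums_to sums_to0 (ac j j0)) => i i0; apply: a0.
have -> : \sum_(1 <= j < J) c j = \sum_(1 <= j < J | (0 < j)%N) c j.
  by rewrite [RHS]big_nat_cond; rewrite [LHS]big_nat_cond; apply: eq_bigl => j;
    case: j => //=; rewrite ?andbT.
have cc := sums_to_sum (s := index_iota 1 J) (u := fun j i => a i j) ac.
apply: (le_sums_to cc rS) => i i0.
have -> : \sum_(1 <= j < J | (0 < j)%N) a i j = \sum_(1 <= j < J) a i j.
  by rewrite [LHS]big_nat_cond; rewrite [RHS]big_nat_cond; apply: eq_bigl => j;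
    case: j => //=; rewrite ?andbT.
by apply: sums_to_ge_partial (ar _ i0) => j j0; apply: a0.
Qed.

(** Tonelli: the one-sided version is applied to [a] and then to its transpose, whose outer series
    is by then known to converge. Convergence of [c] is thus obtained, not assumed. *)
Lemma sums_to_swap (a : nat -> nat -> R) r S c :
  (forall i j, (0 < i)%N -> (0 < j)%N -> 0 <= a i j) ->
  (forall i, (0 < i)%N -> sums_to (a i) (r i)) -> sums_to r S ->
  (forall j, (0 < j)%N -> sums_to (a ^~ j) (c j)) ->
  sums_to c S.
Proof.
move=> a0 ar rS ac; have [cc cS] := sums_to_swap_le a0 ar rS ac.
have a0' j i : (0 < j)%N -> (0 < i)%N -> 0 <= a i j by move=> *; apply: a0.
have [_ Sc] := sums_to_swap_le a0' ac cc ar.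
by rewrite (sum_ge1E rS) in Sc; have -> : S = sum_ge1 c by apply/le_anti/andP.
Qed.

Unset Implicit Arguments.
Set Strict Implicit.
End SumsTo.

(** * Central binomial ratios, harmonic numbers, convergence of the basic series *)

Section BinomHarm.
Context {R : realType}.
Implicit Types (n m p N : nat).
Local Notation b n := (@binom_ratio R n).
Local Notation H n := (harm R 1 n).
Local Open Scope classical_set_scope.

Lemma binom_ratio0 : b 0 = 1.
Proof. by rewrite /binom_ratio bin0 expr0 divr1. Qed.

Lemma binom_ratioS n : b n.+1 = b n * ((2 * n%:R + 1) / (2 * n%:R + 2)).
Proof.
have E : ('C(2 * n.+1, n.+1) * n.+1 = 2 * (2 * n + 1) * 'C(2 * n, n))%N.
  have -> : (2 * n.+1 = (2 * n).+2)%N by lia.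
  rewrite binS -['C((2 * n).+1, n)]bin_sub; last by lia.
  have -> : ((2 * n).+1 - n = n.+1)%N by lia.
  have := mul_bin_diag (2 * n).+1 n; rewrite /=; lia.
have {}E : ('C(2 * n.+1, n.+1)%:R : R) * (n%:R + 1)
    = 2 * (2 * n%:R + 1) * 'C(2 * n, n)%:R.
  by rewrite natr1 -natrM E !natrM natrD natrM.
have n0 : (n%:R : R) + 1 != 0 by rewrite natr1 pnatr_eq0.
have {}E : ('C(2 * n.+1, n.+1)%:R : R)
    = 2 * (2 * n%:R + 1) * 'C(2 * n, n)%:R / (n%:R + 1) by rewrite -E mulfK.
rewrite /binom_ratio E exprS; field.
rewrite expf_neq0 //= n0 /=.
have -> : 2 * (n%:R : R) + 2 = 2 * (n%:R + 1) by ring.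
by rewrite mulf_neq0.
Qed.

Lemma binom_ratio_gt0 n : 0 < b n.
Proof.
rewrite divr_gt0 ?exprn_gt0 // ltr0n bin_gt0; lia.
Qed.

Lemma binom_ratio_ge0 n : 0 <= b n.
Proof. exact/ltW/binom_ratio_gt0. Qed.

Lemma binom_ratioS_mul n : (n%:R + 1) * b n.+1 = (n%:R + 1 / 2) * b n.
Proof.
rewrite binom_ratioS; field.
have -> : 2 * (n%:R : R) + 2 = 2 * n.+1%:R by rewrite -natr1; ring.
by rewrite mulf_neq0 // pnatr_eq0.
Qed.

(** Far from sharp, but it lets a factor 1/n be traded for 2 b_n, so that series without b_n are
    dominated by series with it. *)
Lemma binom_ratio_lower n : (0 < n)%N -> 1 <= 2 * n%:R * b n.
Proof.
case: n => // n _; elim: n => [|n IH].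
  by rewrite binom_ratioS binom_ratio0 mulr0 !add0r; lra.
have := binom_ratioS_mul n.+1; have := binom_ratio_gt0 n.+1.
by rewrite -(natr1 n.+1); nra.
Qed.

(** The left side decreases in n, the ratio of successive values being (2n+1)(2n+3) / (2n+2)^2. This
    is the decay of order n^(-1/2) that makes the boundary terms of the telescoping sums vanish. *)
Lemma binom_ratio_sqr_le n : (2 * n%:R + 1) * b n ^+ 2 <= 1.
Proof.
elim: n => [|n IH]; first by rewrite binom_ratio0; lra.
apply: le_trans IH; rewrite binom_ratioS exprMn -natr1.
rewrite mulrCA [leRHS]mulrC ler_wpM2l ?sqr_ge0 //.
have n0 := ler0n R n.
rewrite expr_div_n mulrA ler_pdivrMr; last by nra.
by rewrite -subr_ge0; nra.
Qed.

Lemma binom_ratio_cvg0 : (fun n => b n) @ \oo --> (0 : R).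
Proof.
have sq0 : (fun n => b n ^+ 2) @ \oo --> (0 : R).
  apply: (@squeeze_cvgr _ _ _ _ (fun=> 0) harmonic).
  - near=> n; rewrite sqr_ge0 /= /harmonic.
    rewrite -[leRHS]div1r ler_pdivlMr ?ltr0n // -natr1.
    have := binom_ratio_sqr_le n; have := ler0n R n.
    have := sqr_ge0 (b n); nra.
  - exact: cvg_cst.
  - exact: cvg_harmonic.
have : (fun n => Num.sqrt (b n ^+ 2)) @ \oo --> (Num.sqrt 0 : R).
  by apply: continuous_cvg sq0; exact: sqrt_continuous.
rewrite sqrtr0; under eq_fun do rewrite sqrtr_sqr ger0_norm ?binom_ratio_ge0 //.
by [].
Unshelve. all: by end_near. Qed.

Lemma harm0 s : harm R s 0 = 0.
Proof. by rewrite /harm big_geq. Qed.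

Lemma harmS s n : harm R s n.+1 = harm R s n + (n.+1%:R ^+ s)^-1.
Proof. by rewrite /harm big_nat_recr. Qed.

Lemma harm_ge0 s n : 0 <= harm R s n.
Proof. by apply: sumr_ge0 => k _; rewrite invr_ge0 exprn_ge0. Qed.

Lemma harm_ge1 s n : (0 < n)%N -> 1 <= harm R s n.
Proof.
case: n => // n _; rewrite /harm big_nat_recl // expr1n invr1 lerDl.
by apply: sumr_ge0 => k _; rewrite invr_ge0 exprn_ge0.
Qed.

Lemma harm_le s t n : (s <= t)%N -> harm R t n <= harm R s n.
Proof.
move=> st; apply: ler_sum_nat => -[|k] // _.
by rewrite lef_pV2 ?posrE ?exprn_gt0 // ler_weXn2l // ler1n.
Qed.

Lemma harm_div_cvg0 : (fun n => H n / n%:R) @ \oo --> (0 : R).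
Proof.
rewrite -cvg_shiftS /=; have := cesaro (@cvg_harmonic R).
apply: cvg_trans; apply: near_eq_cvg; near=> n.
rewrite /arithmetic_mean /= mulrC; congr (_ / _).
rewrite /series /= /harm big_add1 /=; apply: eq_bigr => k _.
by rewrite expr1.
Unshelve. all: by end_near. Qed.

(* A discrete potential: its decrement dominates the summand of
   [\sum b_n H_n^2 / n], which therefore converges. *)
Definition harm_potential n : R := b n * (H n ^+ 2 + 4 * H n + 10).

Lemma harm_potential_ge0 n : 0 <= harm_potential n.
Proof.
rewrite mulr_ge0 ?binom_ratio_ge0 //.
by have := harm_ge0 1 n; have := sqr_ge0 (H n); lra.
Qed.

(** Write h = H_n, y = 1/(n+1) and take h^2 + u h + v in the potential. To first order in y, the
    right side minus the left side is b_n y ((u - 4) h + v - 2 u): [4] cancels the term in h, and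
    [10] exceeds 2 * 4, leaving a positive remainder. The terms of higher order are nonnegative as
    well. *)
Lemma harm_potential_decr n :
  b n * H n ^+ 2 / n.+1%:R <= 2 * (harm_potential n - harm_potential n.+1).
Proof.
rewrite /harm_potential binom_ratioS harmS expr1.
have y0 : 0 < (n.+1%:R : R)^-1 by rewrite invr_gt0.
have -> : (2 * n%:R + 1) / (2 * n%:R + 2) = 1 - (n.+1%:R : R)^-1 / 2.
  rewrite -natr1; field.
  have -> : 2 * (n%:R : R) + 2 = 2 * n.+1%:R by rewrite -natr1; ring.
  by rewrite nat1r pnatr_eq0 /= mulf_neq0 // pnatr_eq0.
move: (n.+1%:R^-1 : R) y0 => y y0.
have := harm_ge0 1 n; have := binom_ratio_gt0 n.
move: (b n) (H n) => c h c0 h0; rewrite -subr_ge0.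
have -> : 2 * (c * (h ^+ 2 + 4 * h + 10)
    - c * (1 - y / 2) * ((h + y) ^+ 2 + 4 * (h + y) + 10)) - c * h ^+ 2 * y
  = c * y * (2 + 2 * y + 2 * y * h + y ^+ 2) by field.
by rewrite !mulr_ge0 ?ltW //; nra.
Qed.

(** The root of all convergence below: the series for [S_], [S_2], [zeta], the Euler sums and
    [bconn] are all dominated, directly or in turn, by this one. *)
Lemma binom_harm_sums p : (0 < p)%N ->
  sums_to (fun n => H n ^+ 2 * b n / n%:R ^+ p) (S_11 R p).
Proof.
move=> p0; set v : nat -> R := fun n => b n * H n ^+ 2 / n.+1%:R.
have v0 n : 0 <= v n.
  by rewrite divr_ge0 // mulr_ge0 ?exprn_ge0 ?harm_ge0 // binom_ratio_ge0.
have vs : sums_to v (sum_ge1 v).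
  apply: (@sums_to_bounded _ v (2 * harm_potential 1) _ _).1 => // N.
  case: N => [|N]; first by rewrite big_geq // mulr_ge0 // harm_potential_ge0.
  have : \sum_(1 <= n < N.+1) v n
      <= 2 * (harm_potential 1 - harm_potential N.+1).
    elim: N => [|N IH]; first by rewrite big_geq // subrr mulr0.
    rewrite big_nat_recr //=; have := harm_potential_decr N.+1.
    by rewrite -/(v _); lra.
  by have := harm_potential_ge0 N.+1; lra.
apply: (@sums_to_le _ _ (fun n => 2 * v n)); last exact: sums_toZ vs.
move=> n n0; have n0' : 0 < (n%:R : R) by rewrite ltr0n.
have c0 : 0 <= H n ^+ 2 * b n.
  by rewrite mulr_ge0 ?exprn_ge0 ?harm_ge0 // binom_ratio_ge0.
rewrite divr_ge0 ?exprn_ge0 //=.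
have -> : 2 * v n = H n ^+ 2 * b n * (2 / n.+1%:R) by rewrite /v; ring.
rewrite ler_wpM2l // -[leLHS]div1r.
rewrite ler_pdivrMr ?exprn_gt0 // mulrAC ler_pdivlMr // mul1r.
have n1 : 1 <= (n%:R : R) by rewrite ler1n.
have : (n%:R : R) ^+ 1 <= n%:R ^+ p by rewrite ler_weXn2l.
by rewrite expr1 -natr1; lra.
Qed.

Lemma binom_sums p : (0 < p)%N ->
  sums_to (fun n => b n / n%:R ^+ p) (S_ R p).
Proof.
move=> p0; apply: (sums_to_le _ (binom_harm_sums p p0)) => n n0.
rewrite divr_ge0 ?exprn_ge0 ?binom_ratio_ge0 //=.
rewrite ler_wpM2r ?invr_ge0 ?exprn_ge0 //.
by rewrite ler_peMl ?binom_ratio_ge0 // exprn_ege1 // harm_ge1.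
Qed.

Lemma binom_harm2_sums p : (0 < p)%N ->
  sums_to (fun n => harm R 2 n * b n / n%:R ^+ p) (S_2 R p).
Proof.
move=> p0; apply: (sums_to_le _ (binom_harm_sums p p0)) => n n0.
have := binom_ratio_gt0 n; have := harm_ge1 1 n n0.
have h12 := harm_le 1 2 n isT; have := harm_ge0 2 n => h2 h1 b0.
rewrite divr_ge0 ?exprn_ge0 ?mulr_ge0 ?binom_ratio_ge0 //=.
by rewrite ler_wpM2r ?invr_ge0 ?exprn_ge0 // ler_wpM2r ?binom_ratio_ge0 //; nra.
Qed.

Lemma harm_pow_sums p : (2 <= p)%N ->
  sums_to (fun n => H n / n%:R ^+ p) (sum_ge1 (fun n => H n / n%:R ^+ p)).
Proof.
case: p => // p p2; have := sums_toZ (c := 2) (binom_harm_sums p p2).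
apply: sums_to_le => n n0.
rewrite divr_ge0 ?exprn_ge0 ?harm_ge0 //=.
have n0' : 0 < (n%:R : R) by rewrite ltr0n.
rewrite exprS invfM (mulrA (H n)) (mulrA 2) ler_wpM2r ?invr_ge0 ?exprn_ge0 //.
have := binom_ratio_lower n n0; have := harm_ge1 1 n n0 => h1 c1.
rewrite ler_pdivrMr //; have := binom_ratio_gt0 n => b0.
apply: (@le_trans _ _ (H n ^+ 2 * (2 * n%:R * b n))); last first.
  by rewrite le_eqVlt; apply/orP; left; apply/eqP; ring.
by nra.
Qed.

Lemma zeta_sums p : (2 <= p)%N ->
  sums_to (fun n => (n%:R ^+ p)^-1) (zeta R p).
Proof.
move=> p2; apply: (sums_to_le _ (harm_pow_sums p p2)) => n n0.
by rewrite invr_ge0 exprn_ge0 //= ler_peMl ?invr_ge0 ?exprn_ge0 ?harm_ge1.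
Qed.

End BinomHarm.

(** * Taylor coefficients of f at natural numbers and their recurrences *)

Section Connector.
Context {R : realType}.
Implicit Types (n m p N k : nat).
Local Notation b n := (@binom_ratio R n).
Local Open Scope classical_set_scope.

(* Up to sign the [k]-th Taylor coefficient at [N] of
   [f(x) = 1 + \sum_(m >= 1) b_m x / (m + x) = x B(x, 1/2)]. *)
Definition bconn k N : R :=
  sum_ge1 (fun m => b m * m%:R / (m + N)%:R ^+ k.+1).

Lemma bconn_sums k N : (0 < k)%N ->
  sums_to (fun m => b m * m%:R / (m + N)%:R ^+ k.+1) (bconn k N).
Proof.
move=> k0; apply: (sums_to_le _ (binom_sums 1 isT)) => m m0.
have m0' : 0 < (m%:R : R) by rewrite ltr0n.
have mN0 : 0 < ((m + N)%:R : R) by rewrite ltr0n addn_gt0 m0.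
rewrite divr_ge0 ?exprn_ge0 ?mulr_ge0 ?binom_ratio_ge0 //= expr1.
rewrite -mulrA ler_wpM2l ?binom_ratio_ge0 //.
rewrite ler_pdivrMr ?exprn_gt0 // mulrC ler_pdivlMr //.
rewrite -natrM -natrX ler_nat.
apply: (@leq_trans ((m + N) ^ 2)); first by rewrite -mulnn leq_mul ?leq_addr.
by rewrite leq_pexp2l // addn_gt0 m0.
Qed.

Lemma bconn0 k : (0 < k)%N -> bconn k 0 = S_ R k.
Proof.
move=> k0; apply: (sums_to_uniq (bconn_sums k 0 k0)).
apply: (eq_sums_to _ (binom_sums k k0)) => m m0.
rewrite addn0 exprS invfM mulrA mulfK //.
by rewrite pnatr_eq0 -lt0n.
Qed.

Lemma binom_weight_cvg0 (w : nat -> R) :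
  (forall n, (0 < n)%N -> 0 <= w n <= 1) -> (fun n => w n * b n) @ \oo --> (0 : R).
Proof.
move=> w01; apply: (@squeeze_cvgr _ _ _ _ (fun=> 0) (fun n => b n)).
- near=> n; have /w01/andP[w0 w1] : (0 < n)%N by near: n; exists 1%N.
  by rewrite mulr_ge0 ?binom_ratio_ge0 // ler_piMl ?binom_ratio_ge0.
- exact: cvg_cst.
- exact: binom_ratio_cvg0.
Unshelve. all: by end_near. Qed.

(** This is f(N) = 1 / b_N, by induction on N. The recurrence (m+1) b_{m+1} = (m+1/2) b_m makes the
    termwise defect in (N + 1/2) f(N+1) = (N+1) f(N) equal to N + 1 times the difference
    [v m - v m.+1]. *)
Lemma inv_binom_ratio_sums N :
  sums_to (fun m => b m * N%:R / (m + N)%:R) ((b N)^-1 - 1).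
Proof.
elim: N => [|N IH].
  rewrite binom_ratio0 invr1 subrr; apply: eq_sums_to sums_to0 => m _.
  by rewrite mulr0 mul0r.
pose v m : R := m%:R / (m + N)%:R * b m.
have v0 : v @ \oo --> 0.
  apply: binom_weight_cvg0 => n n0; rewrite divr_ge0 //=.
  by rewrite ler_pdivrMr ?ltr0n ?addn_gt0 ?n0 // mul1r ler_nat leq_addr.
have /sums_toZ : sums_to (fun m => v m - v m.+1) (v 1%N).
  by apply: sums_to_telescope v0.
move=> /(_ (N%:R + 1)) /(sums_toD (sums_toZ (c := N%:R + 1) IH)).
have N2 : (N%:R : R) + 1 / 2 != 0.
  by rewrite gt_eqF // ltr_wpDl // divr_gt0.
have N1 : (N%:R : R) + 1 != 0 by rewrite natr1 pnatr_eq0.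
move=> /(sums_toZ (c := (N%:R + 1 / 2)^-1)).
set l := (X in sums_to _ X).
have -> : l = (b N.+1)^-1 - 1.
  have bS := binom_ratioS_mul (R := R) N.
  have -> : b N.+1 = (N%:R + 1 / 2) * b N / (N%:R + 1).
    by rewrite -bS mulrAC mulfV // mul1r.
  rewrite /l /v binom_ratioS binom_ratio0 !mulr0 !add0r add1n -natr1.
  have b0 : b N != 0 by rewrite gt_eqF // binom_ratio_gt0.
  have N0 := ler0n R N.
  field; nonzero.
apply: eq_sums_to => m m0.
have m0' : 0 < (m%:R : R) by rewrite ltr0n.
have mN : (m%:R : R) + N%:R != 0 by rewrite -natrD pnatr_eq0 -lt0n addn_gt0 m0.
have mN1 : (m%:R : R) + N%:R + 1 != 0.
  by rewrite -natrD natr1 pnatr_eq0.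
rewrite /v [_ * b m.+1]mulrAC -[m.+1%:R]natr1 binom_ratioS_mul.
have -> : (m.+1 + N)%:R = m%:R + N%:R + 1 :> R by rewrite addSn -natr1 natrD.
have -> : (m + N.+1)%:R = m%:R + N%:R + 1 :> R by rewrite addnS -natr1 natrD.
rewrite natrD -[N.+1%:R]natr1; move: (b m) => c.
have N0 := ler0n R N.
field; nonzero.
Qed.

Lemma bconn_weight_cvg0 k N : (0 < k)%N ->
  (fun m => (m%:R - 1) * m%:R / (m + N)%:R ^+ k.+1 * b m) @ \oo --> (0 : R).
Proof.
move=> k0; apply: binom_weight_cvg0 => n n0.
have n1 : 1 <= (n%:R : R) by rewrite ler1n.
have nN0 : 0 < ((n + N)%:R : R) by rewrite ltr0n addn_gt0 n0.
rewrite divr_ge0 ?exprn_ge0 ?mulr_ge0 //= ?subr_ge0 //.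
rewrite ler_pdivrMr ?exprn_gt0 // mul1r.
apply: (@le_trans _ _ ((n * n)%:R)); first by rewrite natrM; nra.
rewrite -natrX ler_nat.
apply: (@leq_trans ((n + N) ^ 2)); first by rewrite -mulnn leq_mul ?leq_addr.
by rewrite leq_pexp2l // addn_gt0 n0.
Qed.

(** The functional equation differentiated k times at N, before separation into series. The bracket
    collapses to (m-1)/(m+N)^(k+1) - (m+1/2)/(m+N+1)^(k+1), which times m b_m is the decrement of
    (m-1) m b_m / (m+N)^(k+1), a sequence starting at 0. The quotients (m+N)/(m+N)^(k+1) stay
    uncancelled because they stand for the terms of index k - 1. *)
Lemma bconn_telescope k N : (0 < k)%N ->
  sums_to (fun m => b m * m%:R *
     ((N%:R + 1 / 2) / (m + N.+1)%:R ^+ k.+1 - (m + N.+1)%:R / (m + N.+1)%:R ^+ k.+1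
      - ((N%:R + 1) / (m + N)%:R ^+ k.+1 - (m + N)%:R / (m + N)%:R ^+ k.+1))) (0 : R).
Proof.
move=> k0; have := sums_to_telescope (fun n _ => erefl) (bconn_weight_cvg0 k N k0).
rewrite subrr !mul0r; apply: eq_sums_to => m m0.
rewrite addSnnS -[m.+1%:R]natr1; have := binom_ratioS_mul (R := R) m.
move: (_ ^- _ : R) (_ ^- _ : R) => c d.
rewrite !natrD -[N.+1%:R]natr1.
move: (m%:R : R) (N%:R : R) (b m) (b m.+1) => x y r s E.
have -> : (x + 1 - 1) * (x + 1) * c * s = x * c * ((x + 1) * s) by ring.
by rewrite E; field.
Qed.

(** Separate from the general recurrence because the terms of index 0, b_m m / (m + N), have a
    divergent sum. Only their difference for N and N + 1 is summable; writing m/(m+N) = 1 - N/(m+N)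
    turns it into values of f. *)
Lemma bconn_rec1 N : (N%:R + 1 / 2) * bconn 1 N.+1 + (b N.+1)^-1
  = (N%:R + 1) * bconn 1 N + (b N)^-1.
Proof.
have h1 := sums_toZ (c := N%:R + 1 / 2) (bconn_sums 1 N.+1 isT).
have h2 := sums_toZ (c := N%:R + 1) (bconn_sums 1 N isT).
have h3 := sums_toB (sums_toD h1 (inv_binom_ratio_sums N.+1))
  (sums_toD h2 (inv_binom_ratio_sums N)).
suff : (N%:R + 1 / 2) * bconn 1 N.+1 + ((b N.+1)^-1 - 1)
    - ((N%:R + 1) * bconn 1 N + ((b N)^-1 - 1)) = 0 by lra.
apply: (sums_to_uniq _ (bconn_telescope 1 N isT)).
apply: eq_sums_to h3 => m m0.
have mN : (m%:R : R) + N%:R != 0 by rewrite -natrD pnatr_eq0 -lt0n addn_gt0 m0.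
have mN1 : (m%:R : R) + N%:R + 1 != 0.
  by rewrite -natrD natr1 pnatr_eq0.
have -> : (m + N.+1)%:R = m%:R + N%:R + 1 :> R by rewrite addnS -natr1 natrD.
rewrite natrD -[N.+1%:R]natr1; move: (b m) => c.
have m0' : 0 < (m%:R : R) by rewrite ltr0n.
have N0 := ler0n R N.
field; nonzero.
Qed.

Lemma bconn_rec k N : (0 < k)%N ->
  (N%:R + 1 / 2) * bconn k.+1 N.+1 - bconn k N.+1
  = (N%:R + 1) * bconn k.+1 N - bconn k N.
Proof.
move=> k0.
have h1 := sums_toZ (c := N%:R + 1 / 2) (bconn_sums k.+1 N.+1 isT).
have h2 := sums_toZ (c := N%:R + 1) (bconn_sums k.+1 N isT).
have h3 := sums_toB (sums_toB h1 (bconn_sums k N.+1 k0))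
  (sums_toB h2 (bconn_sums k N k0)).
apply/eqP; rewrite -subr_eq0; apply/eqP.
apply: (sums_to_uniq _ (bconn_telescope k.+1 N isT)).
apply: eq_sums_to h3 => m m0.
have mN : ((m + N)%:R : R) != 0 by rewrite pnatr_eq0 -lt0n addn_gt0 m0.
have mN1 : ((m + N.+1)%:R : R) != 0 by rewrite pnatr_eq0 addnS.
rewrite !(exprS _ k.+1) ![in RHS]invfM.
move: (b m) ((m + N)%:R : R) ((m + N.+1)%:R : R) mN mN1 => c x y x0 y0.
rewrite !(mulrA x) !(mulrA y) !mulfV // !mul1r !invfM.
ring.
Qed.

(** Since m / (m+N)^(k+1) <= 1 / (m+N), the sum is at most (f(N) - 1) / N. With f(N) = 1 / b_N this
    shows that f(N + t) / f(N) tends to 1 coefficientwise. *)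
Lemma bconn_le k N : (0 < k)%N -> (0 < N)%N ->
  0 <= b N * bconn k N <= (N%:R)^-1.
Proof.
move=> k0 N0; have N0' : 0 < (N%:R : R) by rewrite ltr0n.
have bN := binom_ratio_gt0 (R := R) N.
have c0 : 0 <= bconn k N.
  apply: (le_sums_to sums_to0 (bconn_sums k N k0)) => m _.
  by rewrite divr_ge0 ?exprn_ge0 ?mulr_ge0 ?binom_ratio_ge0.
rewrite mulr_ge0 ?binom_ratio_ge0 //=.
rewrite -ler_pdivlMl //.
have : bconn k N <= N%:R^-1 * ((b N)^-1 - 1).
  apply: (le_sums_to (bconn_sums k N k0)
    (sums_toZ (c := N%:R^-1) (inv_binom_ratio_sums N))) => m m0.
  have mN0 : 0 < ((m + N)%:R : R) by rewrite ltr0n addn_gt0 m0.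
  have -> : N%:R^-1 * (b m * N%:R / (m + N)%:R) = b m * (m + N)%:R^-1.
    move: (b m) ((m + N)%:R : R) (N%:R : R) mN0 N0' => c x y x0 y0.
    by field; nonzero.
  rewrite -mulrA ler_wpM2l ?binom_ratio_ge0 //.
  rewrite ler_pdivrMr ?exprn_gt0 // exprS mulKf ?gt_eqF //.
  apply: (@le_trans _ _ ((m + N)%:R ^+ 1)); first by rewrite expr1 ler_nat leq_addr.
  by rewrite ler_weXn2l // ler1n addn_gt0 m0.
by rewrite mulrBr mulr1 [_^-1 * _]mulrC; have : 0 < (N%:R : R)^-1; [rewrite invr_gt0 | lra].
Qed.

End Connector.

(** * Logarithmic derivatives of power series truncated modulo a power of X *)

Section LogDerivative.
Context {R : realType}.
Implicit Types (A B C D l m : {poly R}) (K i k : nat).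
Local Open Scope classical_set_scope.

Definition eqX K A B := forall i, (i < K)%N -> A`_i = B`_i.

Lemma eqX_sym K A B : eqX K A B -> eqX K B A.
Proof. by move=> AB i iK; rewrite AB. Qed.

Lemma eqX_trans K A B C : eqX K A B -> eqX K B C -> eqX K A C.
Proof. by move=> AB BC i iK; rewrite AB // BC. Qed.

Lemma eqXW K K' A B : (K' <= K)%N -> eqX K A B -> eqX K' A B.
Proof. by move=> KK AB i iK; apply: AB; apply: leq_trans KK. Qed.

Lemma eqXD K A B C D : eqX K A B -> eqX K C D -> eqX K (A + C) (B + D).
Proof. by move=> AB CD i iK; rewrite !poly.coefD AB // CD. Qed.

Lemma eqXM K A B C D : eqX K A B -> eqX K C D -> eqX K (A * C) (B * D).
Proof.
move=> AB CD i iK; rewrite !coefM; apply: eq_bigr => j _.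
by rewrite AB ?CD //; have := ltn_ord j; lia.
Qed.

Lemma eqX_deriv K A B : eqX K.+1 A B -> eqX K A^`() B^`().
Proof. by move=> AB i iK; rewrite !coef_deriv AB. Qed.

(** The division-free form of A' / A = l. Together with the constant term of A it determines A
    modulo X^(K+1), one degree more than the congruence itself. *)
Definition logderiv K l A := eqX K A^`() (l * A).

Lemma logderivM K l m A B :
  logderiv K l A -> logderiv K m B -> logderiv K (l + m) (A * B).
Proof.
move=> lA mB; rewrite /logderiv derivM mulrDl; apply: eqXD.
  by rewrite mulrA; apply: eqXM.
by rewrite mulrCA; apply: eqXM.
Qed.

Lemma eq_logderiv K l A B : eqX K.+1 A B -> logderiv K l A -> logderiv K l B.
Proof.
move=> AB lA; apply: eqX_trans (eqX_deriv K _ _ (eqX_sym _ _ _ AB)) _.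
by apply: (eqX_trans _ _ _ _ lA); apply: eqXM => //; apply: eqXW AB.
Qed.

(** The recursion (n+1) A_{n+1} = sum of l_j A_{n-j} expresses each coefficient by finitely many
    earlier ones, so limits pass through it degree by degree. *)
Lemma cvg_logderiv K (l_ A_ : nat -> {poly R}) l A :
  (forall N, logderiv K (l_ N) (A_ N)) -> logderiv K l A ->
  (forall N, (A_ N)`_0 = A`_0) ->
  (forall i, (i < K)%N -> (fun N => (l_ N)`_i) @ \oo --> l`_i) ->
  forall k, (k <= K)%N -> (fun N => (A_ N)`_k) @ \oo --> A`_k.
Proof.
move=> lA_ lA A0 ll k; elim: k {-2}k (leqnn k) => [|n IH] k.
  rewrite leqn0 => /eqP -> _; under eq_fun do rewrite A0; exact: cvg_cst.
rewrite leq_eqVlt => /orP[/eqP -> nK|]; last by rewrite ltnS; apply: IH.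
have E N : (A_ N)`_n.+1
    = (\sum_(j < n.+1) (l_ N)`_j * (A_ N)`_(n - j)) / n.+1%:R.
  by rewrite -coefM -lA_ // coef_deriv -(mulr_natr (A_ N)`_n.+1) mulfK // pnatr_eq0.
have -> : A`_n.+1 = (\sum_(j < n.+1) l`_j * A`_(n - j)) / n.+1%:R.
  by rewrite -coefM -lA // coef_deriv -(mulr_natr A`_n.+1) mulfK // pnatr_eq0.
under eq_fun do rewrite E.
apply: cvgMr_tmp; apply: cvg_big => [|j _]; first exact: add_continuous.
by apply: cvgM; [apply: ll | apply: IH]; have := ltn_ord j; lia.
Qed.

Definition inv_linear K (y : R) : {poly R} :=
  \poly_(i < K) ((-1) ^+ i / y ^+ i.+1).

Lemma coef_linearM (y : R) A i :
  ((y%:P + 'X) * A)`_i = y * A`_i + (if i is j.+1 then A`_j else 0).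
Proof. by rewrite mulrDl poly.coefD coefCM coefXM; case: i. Qed.

Lemma inv_linearP K (y : R) : y != 0 ->
  eqX K ((y%:P + 'X) * inv_linear K y) 1.
Proof.
move=> y0 i iK; rewrite coef_linearM coef1 coef_poly iK.
case: i iK => [|i] iK; first by rewrite expr0 expr1 addr0 mul1r mulfV.
rewrite coef_poly ltnW // (exprS y i.+1) (exprS (-1)).
have yi : y ^+ i.+1 != 0 by rewrite expf_neq0.
by move: (y ^+ i.+1) yi => z z0 /=; field; nonzero.
Qed.

Lemma logderiv_linear K (y : R) : y != 0 ->
  logderiv K (inv_linear K y) (y%:P + 'X).
Proof.
move=> y0; rewrite /logderiv derivD derivC derivX add0r mulrC.
exact/eqX_sym/inv_linearP.
Qed.

(** Differentiating Y J = 1 costs one degree, hence the truncation at [K.+1]. It gives J + Y J' = 0,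
    and then J' = J' (Y J) = (J + Y J') J - J^2 = - J^2. *)
Lemma logderiv_inv_linear K (y : R) : y != 0 ->
  logderiv K (- inv_linear K.+1 y) (inv_linear K.+1 y).
Proof.
move=> y0; set J := inv_linear K.+1 y; set Y : {poly R} := y%:P + 'X.
have YJ : eqX K.+1 (Y * J) 1 by apply: inv_linearP.
have dYJ := eqX_deriv K _ _ YJ; rewrite derivM in dYJ.
have Y' : deriv Y = 1 by rewrite /Y derivD derivC derivX add0r.
rewrite Y' mul1r -polyC1 derivC in dYJ.
rewrite /logderiv; apply: (@eqX_trans _ _ (deriv J * (Y * J))).
  rewrite -[X in eqX _ X]mulr1; apply: eqXM => //.
  by apply: eqX_sym; apply: eqXW YJ.
have -> : deriv J * (Y * J) = (J + Y * deriv J) * J - J * J by ring.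
rewrite -[X in eqX _ _ X](add0r) mulNr; apply: eqXD => //.
by rewrite -[X in eqX _ _ X](mul0r J); apply: eqXM.
Qed.

Lemma logderivZ K l (c : R) A : logderiv K l A -> logderiv K l (c *: A).
Proof.
by move=> lA i iK; rewrite derivZ -scalerAr !coefZ lA.
Qed.

End LogDerivative.

(** * Bell polynomials as coefficients of a truncated exponential *)

Section BellSeries.
Context {R : realType}.
Implicit Types (A B E : {poly R}) (x : nat -> R) (K M i k m n : nat).

Definition expX M E : {poly R} :=
  \sum_(0 <= m < M.+1) (m`!%:R)^-1 *: E ^+ m.

Definition exponent x M : {poly R} :=
  \sum_(1 <= k < M.+1) (x k / k`!%:R) *: 'X^k.

Lemma coef_exponent x M i :
  (exponent x M)`_i = if (0 < i <= M)%N then x i / i`!%:R else 0.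
Proof.
have -> : exponent x M
    = \poly_(k < M.+1) (if (0 < k)%N then x k / k`!%:R else 0).
  rewrite poly_def /exponent big_add1 big_mkord big_ord_recl /= scale0r add0r.
  by [].
by rewrite coef_poly ltnS; case: i => //= i; case: ifP.
Qed.

Lemma coef_exp_lt E m i : E`_0 = 0 -> (i < m)%N -> (E ^+ m)`_i = 0.
Proof.
move=> E0; elim: m i => // m IH i im; rewrite exprS coefM big1 // => -[j ji] _ /=.
case: j ji => [|j] ji; first by rewrite E0 mul0r.
by rewrite IH ?mulr0 //; lia.
Qed.

Lemma eqX_exp K A B m : eqX K A B -> eqX K (A ^+ m) (B ^+ m).
Proof.
by move=> AB; elim: m => [|m IH] //; rewrite !exprS; apply: eqXM.
Qed.

(** [bellY] truncates at its own degree n; here one truncation M serves all n <= M. Powers beyond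
    the n-th contribute nothing because the exponent has no constant term. *)
Lemma bellY_coef x n M : (n <= M)%N ->
  bellY x n / n`!%:R = (expX M (exponent x M))`_n.
Proof.
move=> nM; rewrite /bellY mulrC mulKf ?pnatr_eq0 -?lt0n ?fact_gt0 //.
rewrite /expX !coef_sum (@big_cat_nat _ _ _ n.+1 0 M.+1) //= [X in _ + X]big_nat_cond.
rewrite [X in _ + X]big1 => [|m].
  rewrite addr0; apply: eq_bigr => m _; rewrite !coefZ; congr (_ * _).
  apply: (@eqX_exp n.+1) => // i iN; rewrite !coef_exponent.
  by have -> : (i <= M)%N = (i <= n)%N by lia.
move=> /andP[/andP[nm _] _]; rewrite coefZ coef_exp_lt ?mulr0 //.
by rewrite coef_exponent.
Qed.

Lemma deriv_expX E M : deriv (expX M.+1 E) = deriv E * expX M E.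
Proof.
elim: M => [|M IH].
  rewrite /expX !big_nat_recr ?big_geq //= !add0r expr0 expr1 fact0 invr1 !scale1r.
  by rewrite derivD -polyC1 derivC add0r mulr1.
rewrite {1}/expX big_nat_recr //= derivD -/(expX M.+1 E) IH.
rewrite [in RHS]/expX [in RHS]big_nat_recr //= mulrDr; congr (_ + _).
rewrite derivZ deriv_exp -[(_ * _) *+ _]scaler_nat scalerA -scalerAr -pred_Sn factS; congr (_ *: _).
have M0 : (M.+2%:R : R) != 0 by rewrite pnatr_eq0.
by rewrite natrM invfM mulrAC mulVf // mul1r.
Qed.

(** Differentiation removes the last term of the truncated exponential; the lost power of E has
    order above K, hence vanishes modulo X^K. *)
Lemma logderiv_expX K E : E`_0 = 0 -> logderiv K (deriv E) (expX K.+1 E).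
Proof.
move=> E0; rewrite /logderiv deriv_expX; apply: eqXM => // i iK.
rewrite [in RHS]/expX big_nat_recr //= poly.coefD coefZ coef_exp_lt ?mulr0 ?addr0 //.
by lia.
Qed.

Lemma logderiv_bellY x K :
  logderiv K (\poly_(i < K) (x i.+1 / i`!%:R))
    (\poly_(i < K.+1) (bellY x i / i`!%:R)).
Proof.
have E0 : (exponent x K.+1)`_0 = 0 by rewrite coef_exponent.
apply: (@eq_logderiv _ _ _ (expX K.+1 (exponent x K.+1))).
  by move=> i iK; rewrite coef_poly iK (bellY_coef _ _ K.+1) // ltnW.
apply: (eqX_trans _ _ _ _ (logderiv_expX K _ E0)); apply: eqXM => // i iK.
rewrite coef_deriv coef_exponent coef_poly iK /= ltnS ltnW //.
have i0 : (i.+1%:R : R) != 0 by rewrite pnatr_eq0.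
have f0 : (i`!%:R : R) != 0 by rewrite pnatr_eq0 -lt0n fact_gt0.
rewrite factS natrM -[_ / _ *+ _]mulr_natr; move: (x i.+1) (i.+1%:R : R) (i`!%:R : R) i0 f0.
by move=> y u v u0 v0; field; nonzero.
Qed.

Lemma bellY0 x : bellY x 0 / 0`!%:R = 1.
Proof.
rewrite (bellY_coef x 0 0) // /expX big_nat1 expr0 fact0 invr1 scale1r.
by rewrite coef1.
Qed.

(** The substitution t -> c t; the chain rule accounts for the additional factor c in the
    logarithmic derivative. *)
Lemma logderiv_scale K (c : R) (l a : nat -> R) :
  logderiv K (\poly_(i < K) l i) (\poly_(i < K.+1) a i) ->
  logderiv K (\poly_(i < K) (c ^+ i.+1 * l i)) (\poly_(i < K.+1) (c ^+ i * a i)).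
Proof.
move=> la k kK; have := la k kK.
rewrite !coef_deriv !coef_poly ltnS kK => E.
rewrite -mulrnAr E !coefM mulr_sumr; apply: eq_bigr => -[j /= jk] _.
rewrite !coef_poly; have -> : (j < K)%N by lia.
have -> : (k - j < K.+1)%N by lia.
have -> : c ^+ k.+1 = c ^+ j.+1 * c ^+ (k - j) by rewrite -exprD; congr (_ ^+ _); lia.
by ring.
Qed.

Lemma logderiv_exp K (a : R) :
  logderiv K a%:P (\poly_(i < K.+1) (a ^+ i / i`!%:R)).
Proof.
move=> k kK; rewrite coef_deriv coefCM !coef_poly ltnS kK ltnS ltnW //.
have i0 : (k.+1%:R : R) != 0 by rewrite pnatr_eq0.
have f0 : (k`!%:R : R) != 0 by rewrite pnatr_eq0 -lt0n fact_gt0.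
rewrite factS natrM -[_ / _ *+ _]mulr_natr exprS.
move: (k.+1%:R : R) (k`!%:R : R) i0 f0 (a ^+ k) => u v u0 v0 w.
by field; nonzero.
Qed.

End BellSeries.

(** * The product expansion of f at 0 as a limit of finite products *)

Section Identification.
Context {R : realType}.
Implicit Types (K N i k n s : nat).
Local Notation b n := (@binom_ratio R n).
Local Open Scope classical_set_scope.

Lemma harm_cvg s : (2 <= s)%N -> (fun N => harm R s N) @ \oo --> zeta R s.
Proof.
move=> s2; have := zeta_sums (R := R) s s2.
by rewrite /sums_to -cvg_shiftS.
Qed.

Lemma cvg_double (u : nat -> R) (l : R) :
  u @ \oo --> l -> (fun N => u (2 * N)%N) @ \oo --> l.
Proof. by move=> ul; apply: (cvg_comp (muln 2) u _ ul); apply: cvg_mulnl. Qed.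

Lemma ln_diff_bounds n : (0 < n)%N ->
  n.+1%:R^-1 <= ln (n.+1%:R : R) - ln n%:R <= n%:R^-1.
Proof.
move=> n0; have n0' : 0 < (n%:R : R) by rewrite ltr0n.
have n1 : 0 < (n.+1%:R : R) by rewrite ltr0n.
have i1 : 0 < (n.+1%:R : R)^-1 by rewrite invr_gt0.
have i0 : 0 < (n%:R : R)^-1 by rewrite invr_gt0.
apply/andP; split.
  rewrite -lerN2 opprB -ln_div ?posrE //.
  have -> : (n%:R : R) / n.+1%:R = 1 + - n.+1%:R^-1.
    by rewrite -[n%:R](addrK 1) natr1 mulrBl mul1r mulfV // gt_eqF.
  apply: le_ln1Dx; rewrite ltrN2 invf_lt1 // ltr1n; lia.
rewrite -ln_div ?posrE //.
have -> : (n.+1%:R : R) / n%:R = 1 + n%:R^-1.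
  by rewrite -natr1 mulrDl mul1r mulfV // gt_eqF.
by apply: le_ln1Dx; lra.
Qed.

Lemma harm_double_diff_cvg :
  (fun N => harm R 1 (2 * N) - harm R 1 N) @ \oo --> (ln 2 : R).
Proof.
rewrite -cvg_shiftS /=.
apply: (@squeeze_cvgr _ _ _ _ (fun N => ln 2 - N.+1%:R^-1) (fun=> ln 2)).
(* Stated for all k so that it can be proved by induction; k = N + 1 gives the squeeze, since
   ln(2N+3) >= ln 2 + ln(N+1) and ln(N+2) - ln(N+1) <= 1/(N+1). *)
- near=> N; have bnd k : (0 < k)%N ->
    ln (N.+1 + k).+1%:R - ln N.+2%:R <= harm R 1 (N.+1 + k) - harm R 1 N.+1
      <= ln (N.+1 + k)%:R - ln (N.+1%:R : R).
    case: k => // k _; elim: k => [|k /andP[IH1 IH2]].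
      rewrite addn1 harmS expr1 addrAC subrr add0r.
      have /andP[h1 h2] := ln_diff_bounds N.+2 isT.
      have /andP[h3 h4] := ln_diff_bounds N.+1 isT.
      by rewrite h2 h3.
    rewrite addnS (harmS 1 (N.+1 + k.+1)) expr1; move: IH1 IH2.
    have /andP[h1 h2] := ln_diff_bounds (N.+1 + k.+1).+1 isT.
    have /andP[h3 h4] := ln_diff_bounds (N.+1 + k.+1) isT.
    move: h1 h2 h3 h4; set x1 := ln _; set x2 := ln _; set x3 := ln _.
    move: (_ ^-1) (_ ^-1) (_ ^-1) => y1 y2 y3 h1 h2 h3 h4.
    move=> IH1 IH2; apply/andP; split; lra.
  have := bnd N.+1 isT; rewrite addnn -mul2n.
  have lo : ln (2 * N.+1)%:R <= ln (2 * N.+1).+1%:R :> R.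
    by rewrite ler_ln ?posrE ?ltr0n // ler_nat.
  have e1 : ln (2 * N.+1)%:R = ln 2 + ln N.+1%:R :> R.
    by rewrite natrM lnM ?posrE ?ltr0n.
  have /andP[_ h4] := ln_diff_bounds N.+1 isT.
  move: lo e1 h4; move: (_ ^-1) => y lo e1 h4 /andP[h5 h6].
  by apply/andP; split; lra.
- rewrite -[X in _ --> X]subr0; apply: cvgB; first exact: cvg_cst.
  exact: cvg_harmonic.
- exact: cvg_cst.
Unshelve. all: by end_near. Qed.

(** Each term is 2^s / (2j+1)^s, and the odd terms of the sum up to 2N are all of them minus the
    even ones. *)
Lemma sum_half_odd s N : \sum_(j < N) ((j%:R + 1 / 2) ^+ s)^-1
  = 2 ^+ s * harm R s (2 * N) - harm R s N.
Proof.
elim: N => [|N IH]; first by rewrite big_ord0 muln0 !harm0 mulr0 subrr.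
rewrite big_ord_recr /= IH mulnS !harmS.
have -> : (2 * N).+2%:R = 2 * N.+1%:R :> R by rewrite -natrM; congr (_%:R); lia.
have -> : (2 * N).+1%:R = 2 * (N%:R + 1 / 2) :> R.
  by rewrite -natr1 natrM; field.
have N1 : (N.+1%:R : R) ^+ s != 0 by rewrite expf_neq0 // pnatr_eq0.
have N2 : (N%:R + 1 / 2 : R) ^+ s != 0.
  by rewrite expf_neq0 // gt_eqF // ltr_wpDl // divr_gt0.
have t0 : (2 : R) ^+ s != 0 by rewrite expf_neq0 // pnatr_eq0.
rewrite !exprMn; move: (_ ^+ s) N1 (_ ^+ s) N2 (_ ^+ s) t0 => x x0 y y0 z z0.
by field; nonzero.
Qed.

(* Partial products of [\prod_(j >= 1) (1 + t / (j - 1/2)) / (1 + t / j)],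
   modulo [t^(K+1)]. *)
Definition wallis K N : {poly R} :=
  \prod_(j < N) ((j%:R + 1) / (j%:R + 1 / 2) *:
    (((j%:R + 1 / 2)%:P + 'X) * inv_linear K.+1 (j%:R + 1))).

Lemma half_neq0 (j : nat) : j%:R + 1 / 2 != 0 :> R.
Proof. by rewrite gt_eqF // ltr_wpDl // divr_gt0. Qed.

Lemma succ_neq0 (j : nat) : j%:R + 1 != 0 :> R.
Proof. by rewrite natr1 pnatr_eq0. Qed.

Lemma logderiv_wallis K N : logderiv K
  (\sum_(j < N) (inv_linear K (j%:R + 1 / 2) - inv_linear K.+1 (j%:R + 1)))
  (wallis K N).
Proof.
elim: N => [|N IH].
  by rewrite /wallis !big_ord0 => i iK; rewrite -polyC1 derivC mul0r.
rewrite /wallis !big_ord_recr /=; apply: logderivM => //.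
apply: logderivZ; apply: logderivM.
  exact/logderiv_linear/half_neq0.
exact/logderiv_inv_linear/succ_neq0.
Qed.

Lemma coef0_wallis K N : (wallis K N)`_0 = 1.
Proof.
rewrite /wallis coef0_prod big1 // => j _.
rewrite coefZ coef0M poly.coefD poly.coefC coefX coef_poly /= addr0 expr0 expr1 mul1r.
have j0 := ler0n R j; field; nonzero.
Qed.

(** The Taylor coefficients of f at N with their signs. Index 0 is the value f(N) itself, because
    the series defining [bconn 0 N] diverges. *)
Definition conn_coef N i : R :=
  if i is k.+1 then (-1) ^+ k * bconn i N else (b N)^-1.

(** The equation (x + 1/2) f(x+1) = (x+1) f(x) at x = N + t. Degrees 0, 1 and at least 2 are, in
    turn, the recurrences for b_N, for [bconn 1] and for the higher [bconn]. *)
Lemma conn_rec K N :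
  eqX K (((N%:R + 1 / 2)%:P + 'X) * \poly_(i < K) conn_coef N.+1 i)
    (((N%:R + 1)%:P + 'X) * \poly_(i < K) conn_coef N i).
Proof.
move=> i iK; rewrite !coef_linearM !coef_poly iK.
case: i iK => [|[|i]] iK /=.
- have := binom_ratioS_mul (R := R) N; have := binom_ratio_gt0 (R := R) N.
  have := binom_ratio_gt0 (R := R) N.+1; move: (b N) (b N.+1) => x y y0 x0 E.
  rewrite !addr0; apply: (mulfI (lt0r_neq0 (mulr_gt0 x0 y0))).
  have -> : x * y * ((N%:R + 1 / 2) * y^-1) = (N%:R + 1 / 2) * x by field; nonzero.
  by rewrite -E; field; nonzero.
- rewrite !coef_poly ltnW // /conn_coef expr0 !mul1r.
  by have := bconn_rec1 (R := R) N; rewrite mul1r.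
- rewrite !coef_poly ltnW //= !(exprS _ i).
  have := bconn_rec (R := R) i.+1 N isT; move: (_ ^+ i) => e E.
  have -> : forall z u v, z * (-1 * e * u) + e * v = - e * (z * u - v) :> R.
    by move=> z u v; ring.
  by rewrite E; ring.
Qed.

(** N steps of the functional equation, with the constants (j+1)/(j+1/2) of the partial product
    absorbed by b_N: f(t) = P_N(t) b_N f(N + t). *)
Lemma wallis_conn K N :
  eqX K.+1 (b N *: (wallis K N * \poly_(i < K.+1) conn_coef N i))
    (\poly_(i < K.+1) conn_coef 0 i).
Proof.
elim: N => [|N IH].
  by rewrite /wallis big_ord0 mul1r binom_ratio0 scale1r.
apply: (eqX_trans _ _ _ _ _ IH).
rewrite /wallis big_ord_recr /= -/(wallis K N).
set F := \poly_(i < _) _; set F' := \poly_(i < _) _.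
set J := inv_linear _ _; set Y := _%:P + 'X.
have -> : b N.+1 *: (wallis K N * ((N%:R + 1) / (N%:R + 1 / 2) *: (Y * J)) * F)
    = b N *: (wallis K N * (J * (Y * F))).
  rewrite -!scalerAr -!scalerAl scalerA; congr (_ *: _); last by ring.
  by rewrite mulrA [b N.+1 * _]mulrC binom_ratioS_mul mulrAC mulfV
    ?mul1r // half_neq0.
move=> i iK; rewrite !coefZ; congr (_ * _).
suff : eqX K.+1 (wallis K N * (J * (Y * F))) (wallis K N * F') by apply.
apply: eqXM => //; apply: (@eqX_trans _ _ _ (J * (((N%:R + 1)%:P + 'X) * F'))).
  by apply: eqXM => //; apply: conn_rec.
rewrite mulrA [J * _]mulrC -[X in eqX _ _ X]mul1r; apply: eqXM => //.
exact/inv_linearP/succ_neq0.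
Qed.

Lemma conn_coef_cvg i : (0 < i)%N ->
  (fun N => b N * conn_coef N i) @ \oo --> (0 : R).
Proof.
case: i => // k _; rewrite -cvg_shiftS /=.
have h : (fun N => b N.+1 * bconn k.+1 N.+1) @ \oo --> (0 : R).
  apply: (@squeeze_cvgr _ _ _ _ (fun=> 0) harmonic).
  - by near=> N; apply: bconn_le.
  - exact: cvg_cst.
  - exact: cvg_harmonic.
have {h} : (fun N => (-1) ^+ k * (b N.+1 * bconn k.+1 N.+1)) @ \oo --> (0 : R).
  by rewrite -(mulr0 ((-1) ^+ k)); apply: cvgMl_tmp.
apply: cvg_trans; apply: near_eq_cvg; near=> N.
by rewrite /conn_coef mulrCA.
Unshelve. all: by end_near. Qed.

(** In f(t) = P_N(t) b_N f(N + t) the left side is constant in N. On the right P_N tends to A by the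
    limit of logarithmic derivatives, while b_N f(N + t) has constant term exactly 1 and its other
    coefficients tend to 0; so A is f. *)
Lemma wallis_cvg K (l A : {poly R}) : logderiv K l A -> A`_0 = 1 ->
  (forall i, (i < K)%N ->
    (fun N => \sum_(j < N) ((-1) ^+ i / (j%:R + 1 / 2) ^+ i.+1
      - (-1) ^+ i / (j%:R + 1) ^+ i.+1)) @ \oo --> l`_i) ->
  eqX K.+1 A (\poly_(i < K.+1) conn_coef 0 i).
Proof.
move=> lA A0 hl k kK.
have wA := cvg_logderiv _ _ _ _ _ (logderiv_wallis K) lA.
have {}wA : forall i, (i <= K)%N -> (fun N => (wallis K N)`_i) @ \oo --> A`_i.
  apply: wA => [N|i iK]; first by rewrite coef0_wallis.
  apply: cvg_trans (hl i iK); apply: near_eq_cvg; near=> N.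
  rewrite coef_sum; apply: eq_bigr => j _.
  by rewrite poly.coefD coefN !coef_poly iK ltnS ltnW.
have lim N : (\poly_(i < K.+1) conn_coef 0 i)`_k
    = \sum_(j < k.+1) (wallis K N)`_j * (b N * conn_coef N (k - j)).
  rewrite -(wallis_conn K N k kK) coefZ coefM mulr_sumr; apply: eq_bigr => j _.
  rewrite coef_poly; have -> : (k - j < K.+1)%N by lia.
  by rewrite mulrCA.
have : (fun N => \sum_(j < k.+1) (wallis K N)`_j * (b N * conn_coef N (k - j)))
    @ \oo --> (\poly_(i < K.+1) conn_coef 0 i)`_k.
  have -> : (fun N => \sum_(j < k.+1) (wallis K N)`_j * (b N * conn_coef N (k - j)))
      = fun=> (\poly_(i < K.+1) conn_coef 0 i)`_k.
    by apply/funext => N; rewrite -lim.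
  exact: cvg_cst.
move=> wF; symmetry; apply: (cvg_unique (@norm_hausdorff _ R) wF).
have -> : (fun N => \sum_(j < k.+1) (wallis K N)`_j * (b N * conn_coef N (k - j)))
    = fun N => \sum_(j < k) (wallis K N)`_j * (b N * conn_coef N (k - j))
      + (wallis K N)`_k.
  apply/funext => N; rewrite big_ord_recr /= subnn /= mulfV ?mulr1 //.
  by rewrite gt_eqF ?binom_ratio_gt0.
rewrite -[A`_k]add0r; apply: cvgD; last exact: wA.
have z : 0 = \sum_(j < k) A`_j * 0 :> R by rewrite big1 // => j _; rewrite mulr0.
rewrite [X in _ --> X]z; apply: cvg_big => [|j _]; first exact: add_continuous.
apply: cvgM; last by apply: conn_coef_cvg; rewrite subn_gt0.
by apply: wA; have := ltn_ord j; lia.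
Unshelve. all: by end_near. Qed.

End Identification.

(** * The generating function of the weights G and the convolution sums *)

Section GSeries.
Context {R : realType}.
Implicit Types (K N i k n s q : nat).
Local Open Scope classical_set_scope.

Definition Cseries K : {poly R} := \poly_(i < K) (Defs.coefC i / i`!%:R).
Definition Dseries K : {poly R} :=
  \poly_(i < K) (2 ^+ i * (Defs.coefD i / i`!%:R)).
Definition Lseries K : {poly R} := \poly_(i < K) ((2 * ln 2) ^+ i / i`!%:R).

Lemma coefGE k1 k2 k3 k4 : coefG k1 k2 k3 k4 =
  (Defs.coefC k1 / k1`!%:R) * (Defs.coefC k2 / k2`!%:R)
  * (2 ^+ k3 * (Defs.coefD k3 / k3`!%:R)) * ((2 * ln 2) ^+ k4 / k4`!%:R) :> R.
Proof.
have f0 n : (n`!%:R : R) != 0 by rewrite pnatr_eq0 -lt0n fact_gt0.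
rewrite /coefG exprD exprMn !natrM.
move: (_`!%:R) (f0 k1) (_`!%:R) (f0 k2) (_`!%:R) (f0 k3) (_`!%:R) (f0 k4).
by move=> x1 h1 x2 h2 x3 h3 x4 h4; field; nonzero.
Qed.

(** C(t)^2 D(2t) e^(2 t ln 2), so that its coefficient at n is the sum of G over k1 + k2 + k3 + k4 =
    n when n < K. *)
Definition Gseries K : {poly R} :=
  Cseries K * Cseries K * Dseries K * Lseries K.

(** The limits of (-1)^i (2^(i+1) H_{2N}^(i+1) - 2 H_N^(i+1)). At i = 0 both harmonic sums diverge
    and only 2 (H_{2N} - H_N) has a limit. *)
Definition Glog i : R := if i is 0%N then 2 * ln 2 else
  (-1) ^+ i * (2 ^+ i.+1 * zeta R i.+1 - 2 * zeta R i.+1).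

Lemma Gseries_logderiv K :
  logderiv K (\poly_(i < K) Glog i) (Gseries K.+1).
Proof.
have f0 n : (n`!%:R : R) != 0 by rewrite pnatr_eq0 -lt0n fact_gt0.
have lC := logderiv_bellY (fun j => if j == 1%N then 0
  else (-1) ^+ j * (j.-1)`!%:R * zeta R j) K.
have lD := logderiv_scale K 2 _ _ (logderiv_bellY (fun j => if j == 1%N then 0
  else (-1) ^+ j.-1 * (j.-1)`!%:R * zeta R j) K).
have lL := logderiv_exp K (2 * ln 2 : R).
have lG := logderivM _ _ _ _ _ (logderivM _ _ _ _ _ (logderivM _ _ _ _ _ lC lC) lD) lL.
apply: (eqX_trans _ _ _ _ lG); apply: eqXM => // i iK.
rewrite !poly.coefD poly.coefC !coef_poly iK.
case: i {iK} => [|i] /=; first by rewrite !mul0r; ring.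
rewrite addr0 (exprS (-1) i.+1).
move: (_`!%:R) (f0 i.+1) (_ ^+ i.+1) => y y0 e.
by field; nonzero.
Qed.

Lemma Gseries0 K : (Gseries K.+1)`_0 = 1.
Proof.
rewrite !coef0M !coef_poly /= !expr0 mul1r.
by rewrite !bellY0 !mul1r fact0 invr1.
Qed.

Lemma Gseries_coef K : eqX K.+1 (Gseries K.+1) (\poly_(i < K.+1) conn_coef 0 i).
Proof.
apply: (wallis_cvg K _ _ (Gseries_logderiv K) (Gseries0 K)) => i iK.
have -> : (fun N => \sum_(j < N) ((-1) ^+ i / (j%:R + 1 / 2) ^+ i.+1
      - (-1) ^+ i / (j%:R + 1) ^+ i.+1))
    = fun N => (-1) ^+ i * (2 ^+ i.+1 * harm R i.+1 (2 * N) - 2 * harm R i.+1 N).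
  apply/funext => N; rewrite sumrB -!mulr_sumr sum_half_odd.
  have -> : \sum_(j < N) ((j%:R + 1) ^+ i.+1)^-1 = harm R i.+1 N.
    rewrite /harm big_add1 /= big_mkord; apply: eq_bigr => j _.
    by rewrite natr1.
  by ring.
rewrite coef_poly iK; case: i {iK} => [|i] /=.
  have -> : (fun N => (-1) ^+ 0 * (2 ^+ 1 * harm R 1 (2 * N) - 2 * harm R 1 N))
      = fun N => 2 * (harm R 1 (2 * N) - harm R 1 N).
    by apply/funext => N; ring.
  by apply: cvgMl_tmp; exact: harm_double_diff_cvg.
apply: cvgMl_tmp; apply: cvgB; apply: cvgMl_tmp; last exact: harm_cvg.
by apply: cvg_double; apply: harm_cvg.
Qed.

(** Peels off one factor and stores the chosen exponent in the power of X, so that repeated use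
    turns a coefficient of a product into the nested sums of the statement. *)
Lemma coef_polyMX n (a : nat -> R) (B : {poly R}) s m :
  (\poly_(k < n) a k * B * 'X^s)`_m
  = \sum_(k < n) a k * (B * 'X^(k + s))`_m.
Proof.
rewrite poly_def -mulrA mulr_suml coef_sum; apply: eq_bigr => k _.
by rewrite -scalerAl coefZ mulrCA -exprD.
Qed.

Lemma sumG_linearE q : (0 < q)%N -> sumG_linear R q
  = \sum_(i < q) conn_coef 0 i * ((q - i)%N%:R * zeta R (q - i).+1).
Proof.
case: q => // q _.
transitivity ((Gseries q.+1
   * \poly_(k < q.+1) ((k + 1)%N%:R * zeta R (k + 2)))`_q).
  rewrite /Gseries.
  (* Right-nested, so that the factors peel off one at a time; the trailing 1 and 'X^0 leave a pure
     power of X, whose coefficient is the index condition. *)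
  have -> : forall A B C D E : {poly R},
     A * B * C * D * E = A * (B * (C * (D * (E * 1)))) * 'X^0.
    by move=> A B C D E; rewrite expr0; ring.
  rewrite coef_polyMX; apply: eq_bigr => k1 _.
  rewrite coef_polyMX mulr_sumr; apply: eq_bigr => k2 _.
  rewrite coef_polyMX !mulr_sumr; apply: eq_bigr => k3 _.
  rewrite coef_polyMX !mulr_sumr; apply: eq_bigr => k4 _.
  rewrite coef_polyMX !mulr_sumr big_mkcond; apply: eq_bigr => k5 _.
  rewrite mul1r coefXn.
  have -> : (q == k5 + (k4 + (k3 + (k2 + (k1 + 0)))))%N
    = (k1 + k2 + k3 + k4 + k5 + 1 == q.+1)%N by lia.
  case: ifP => _; last by rewrite !mulr0.
  by rewrite coefGE mulr1; ring.
rewrite coefM; apply: eq_bigr => -[i /= iq] _.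
rewrite Gseries_coef // !coef_poly iq.
have -> : (q - i < q.+1)%N by lia.
have -> : (q.+1 - i = (q - i).+1)%N by lia.
by rewrite addn1 addn2.
Qed.

Lemma sumG_quadraticE q : (0 < q)%N -> sumG_quadratic R q
  = \sum_(i < q) conn_coef 0 i
     * \sum_(k < q - i - 2) zeta R (k + 2) * zeta R (q - i - 2 + 1 - k).
Proof.
case: q => // q _; pose Z := \poly_(k < q.+1) zeta R (k + 2).
(* The local [q] is one less than the original one; 'X^2 thus encodes k1 + ... + k6 = q - 3 without
   subtraction and yields an empty sum when the total is too small. *)
transitivity ((Gseries q.+1
   * (Z * Z * 'X^2))`_q).
  rewrite /Gseries.
  have -> : forall A B C D E F : {poly R},
     A * B * C * D * (E * E * F) = A * (B * (C * (D * (E * (E * 1))))) * F.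
    by move=> A B C D E F; ring.
  rewrite coef_polyMX; apply: eq_bigr => k1 _.
  rewrite coef_polyMX mulr_sumr; apply: eq_bigr => k2 _.
  rewrite coef_polyMX !mulr_sumr; apply: eq_bigr => k3 _.
  rewrite coef_polyMX !mulr_sumr; apply: eq_bigr => k4 _.
  rewrite coef_polyMX !mulr_sumr; apply: eq_bigr => k5 _.
  rewrite coef_polyMX !mulr_sumr big_mkcond; apply: eq_bigr => k6 _.
  rewrite mul1r coefXn.
  have -> : (q == k6 + (k5 + (k4 + (k3 + (k2 + (k1 + 2))))))%N
    = (k1 + k2 + k3 + k4 + k5 + k6 + 3 == q.+1)%N by lia.
  case: ifP => _; last by rewrite !mulr0.
  by rewrite coefGE mulr1; ring.
rewrite coefM; apply: eq_bigr => -[i /= iq] _.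
rewrite Gseries_coef // coef_poly iq; congr (_ * _).
rewrite coefMXn; case: ltnP => h.
  have -> : (q.+1 - i - 2 = 0)%N by lia.
  by rewrite big_ord0.
have -> : (q.+1 - i - 2 = (q - i - 2).+1)%N by lia.
rewrite coefM; apply: eq_bigr => -[k /= kq] _; rewrite !coef_poly.
have -> : (k < q.+1)%N by lia.
have -> : (q - i - 2 - k < q.+1)%N by lia.
by congr (_ * zeta R _); lia.
Qed.

Lemma conn_coef0S i : conn_coef 0 i.+1 = (-1) ^+ i * S_ R i.+1.
Proof. by rewrite /conn_coef bconn0. Qed.

Lemma conn_coef00 : conn_coef 0 0 = 1 :> R.
Proof. by rewrite /conn_coef binom_ratio0 invr1. Qed.

(** S_1 = f'(0), which is the constant term of the logarithmic derivative because f(0) = 1. *)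
Lemma S_1E : S_ R 1 = 2 * ln 2.
Proof.
have := Gseries_logderiv 1 0 isT.
rewrite coef0M Gseries0 coef_deriv Gseries_coef // !coef_poly /= mul1r mulr1.
by rewrite bconn0.
Qed.

End GSeries.

(** * Linear Euler sums and their reduction to zeta values *)

Section EulerSums.
Context {R : realType}.
Implicit Types (m n p r M N : nat).
Local Notation H n := (harm R 1 n).
Local Open Scope classical_set_scope.

Lemma sums_to_shift (u : nat -> R) (l : R) :
  sums_to (fun n => u n.+1) l <-> sums_to u (u 1%N + l).
Proof.
have E N : \sum_(1 <= n < N.+2) u n = u 1%N + \sum_(1 <= n < N.+1) u n.+1.
  by rewrite big_ltn // big_add1.
rewrite /sums_to; split=> h.
- rewrite -2!cvg_shiftS /=; under eq_fun do rewrite E.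
  apply: cvgD; first exact: cvg_cst.
  rewrite (cvg_shiftS (fun N => \sum_(1 <= n < N) u n.+1)).
  exact: h.
- rewrite -cvg_shiftS /=.
  have -> : (fun N => \sum_(1 <= n < N.+1) u n.+1)
      = fun N => \sum_(1 <= n < N.+2) u n - u 1%N.
    by apply/funext => N; rewrite E addrC addKr.
  have -> : l = u 1%N + l - u 1%N by ring.
  apply: cvgB; last exact: cvg_cst.
  rewrite (cvg_shiftS (fun N => \sum_(1 <= n < N.+1) u n)).
  by rewrite (cvg_shiftS (fun N => \sum_(1 <= n < N) u n)).
Qed.

Lemma sums_to_addn (u : nat -> R) (l : R) m :
  (forall n, (0 < n <= m)%N -> u n = 0) ->
  sums_to (fun n => u (n + m)%N) l -> sums_to u l.
Proof.
elim: m u => [|m IH] u u0 h.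
  by apply: eq_sums_to h => n _; rewrite addn0.
rewrite -[l]add0r -(u0 1%N) //; apply/sums_to_shift; apply: IH => [n nm|].
  by apply: u0; lia.
by apply: eq_sums_to h => n _; rewrite addnS.
Qed.

Lemma sums_to_finite (u : nat -> R) M :
  sums_to (fun n => if (n < M)%N then u n else 0) (\sum_(1 <= n < M) u n).
Proof.
apply: cvg_near_cst; near=> N.
have MN : (M <= N)%N by near: N; exists M.
by rewrite -big_mkcond /= [RHS](big_nat_widen _ _ N).
Unshelve. all: by end_near. Qed.

Lemma inv_addn_cvg0 m : (fun n => ((n + m)%:R : R)^-1) @ \oo --> (0 : R).
Proof.
rewrite -cvg_shiftS /=.
apply: (@squeeze_cvgr _ _ _ _ (fun=> 0) harmonic).
- near=> n; rewrite invr_ge0 ler0n /= /harmonic lef_pV2 ?posrE ?ltr0n //.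
  by rewrite ler_nat addSn ltnS leq_addr.
- exact: cvg_cst.
- exact: cvg_harmonic.
Unshelve. all: by end_near. Qed.

Lemma diff_inv_sums m :
  sums_to (fun n => n%:R^-1 - (n + m)%:R^-1) (H m).
Proof.
elim: m => [|m IH].
  by rewrite harm0; apply: eq_sums_to sums_to0 => n _; rewrite addn0 subrr.
rewrite harmS expr1.
have h : sums_to (fun n => (n + m)%:R^-1 - (n + m.+1)%:R^-1) ((1 + m)%:R^-1 : R).
  apply: (sums_to_telescope _ (inv_addn_cvg0 m)) => n _.
  by rewrite addSnnS.
by apply: eq_sums_to (sums_toD IH h) => n _; ring.
Qed.

Lemma inv_mul_sums m : (0 < m)%N ->
  sums_to (fun n => (n%:R * (n + m)%:R)^-1) (H m / m%:R).
Proof.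
move=> m0; rewrite mulrC.
apply: eq_sums_to (sums_toZ (diff_inv_sums m)) => n n0.
have n0' : 0 < (n%:R : R) by rewrite ltr0n.
have m0' : 0 < (m%:R : R) by rewrite ltr0n.
rewrite natrD; move: (n%:R : R) (m%:R : R) n0' m0' => x y x0 y0.
by field; nonzero.
Qed.

Lemma harm_pred n : (0 < n)%N -> H n = H n.-1 + n%:R^-1.
Proof. by case: n => // n _; rewrite harmS expr1. Qed.

(** Induction on m: H_{n-1} (1/(n+m) - 1/(n+m+1)) is the decrement of H_{n-1}/(n+m), which starts at
    0, plus 1/(n(n+m+1)). The step therefore adds H_{m+1}/(m+1), exactly the increment of (H_m^2 +
    H_m^(2)) / 2. *)
Lemma harm_diff_inv_sums m :
  sums_to (fun n => H n.-1 * (n%:R^-1 - (n + m)%:R^-1))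
    ((H m ^+ 2 + harm R 2 m) / 2).
Proof.
elim: m => [|m IH].
  rewrite !harm0 expr0n /= addr0 mul0r.
  by apply: eq_sums_to sums_to0 => n _; rewrite addn0 subrr mulr0.
have v0 : (fun n => H n.-1 / (n + m)%:R) @ \oo --> (0 : R).
  apply: (@squeeze_cvgr _ _ _ _ (fun=> 0) (fun n => H n / n%:R)).
  - near=> n; have n0 : (0 < n)%N by near: n; exists 1%N.
    rewrite divr_ge0 ?harm_ge0 //=.
    have i0 : 0 < (n%:R : R)^-1 by rewrite invr_gt0 ltr0n.
    rewrite (harm_pred n) //.
    have i1 : ((n + m)%:R : R)^-1 <= n%:R^-1.
      by rewrite lef_pV2 ?posrE ?ltr0n ?addn_gt0 ?n0 // ler_nat leq_addr.
    have := harm_ge0 (R := R) 1 n.-1; have : 0 <= ((n + m)%:R : R)^-1.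
      by rewrite invr_ge0.
    move: i0 i1; move: (_ ^-1) (_ ^-1) => x y *; nra.
  - exact: cvg_cst.
  - exact: harm_div_cvg0.
have h1 := sums_to_telescope (fun n _ => erefl) v0.
have h2 := inv_mul_sums m.+1 isT.
have := sums_toD IH (sums_toD h1 h2).
rewrite /= harm0 mul0r add0r !harmS expr1.
set l := _ + _ / _; set l' := _ / _.
have -> : l = l'.
  have m1 : (m.+1%:R : R) != 0 by rewrite pnatr_eq0.
  by rewrite /l /l'; move: (m.+1%:R : R) m1 => x x0; field; nonzero.
apply: eq_sums_to => n n0.
rewrite (harm_pred n) // addSnnS.
have n0' : 0 < (n%:R : R) by rewrite ltr0n.
have nm : 0 < ((n + m)%:R : R) by rewrite ltr0n addn_gt0 n0.
have nm1 : 0 < ((n + m.+1)%:R : R) by rewrite ltr0n addn_gt0 n0.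
move: (n%:R : R) ((n + m)%:R : R) ((n + m.+1)%:R : R) n0' nm nm1.
by move=> x y z x0 y0 z0; field; nonzero.
Unshelve. all: by end_near. Qed.

Lemma inv_sqr_shift_sums m :
  sums_to (fun n => ((n + m)%:R ^+ 2)^-1) (zeta R 2 - harm R 2 m).
Proof.
elim: m => [|m IH].
  rewrite harm0 subr0; apply: eq_sums_to (zeta_sums 2 isT) => n _.
  by rewrite addn0.
have h : sums_to (fun n => ((n + m)%:R ^+ 2)^-1)
    (((1 + m)%:R ^+ 2)^-1 + (zeta R 2 - harm R 2 m.+1)).
  by rewrite harmS add1n; move: IH; congr sums_to; ring.
have {}h := (sums_to_shift (fun n => ((n + m)%:R ^+ 2)^-1) _).2 h.
by apply: eq_sums_to h => n _; rewrite addSnnS.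
Qed.

Definition euler_sum p : R := sum_ge1 (fun n => H n.-1 / n%:R ^+ p).

Lemma euler_sums p : (2 <= p)%N ->
  sums_to (fun n => H n.-1 / n%:R ^+ p) (euler_sum p).
Proof.
move=> p2; apply: (sums_to_le _ (harm_pow_sums p p2)) => n n0.
rewrite divr_ge0 ?exprn_ge0 ?harm_ge0 //= ler_wpM2r ?invr_ge0 ?exprn_ge0 //.
by rewrite (harm_pred n) // lerDl invr_ge0.
Qed.

Lemma harm_pow_sumsE p : (2 <= p)%N ->
  sums_to (fun n => H n / n%:R ^+ p) (euler_sum p + zeta R p.+1).
Proof.
move=> p2; apply: eq_sums_to (sums_toD (euler_sums p p2) (zeta_sums p.+1 _)); last by lia.
by move=> n n0; rewrite (harm_pred n) // mulrDl exprS invfM.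
Qed.

(** A finite geometric sum in x = 1/n and y = 1/M; its denominator becomes M - n through x - y = (M
    - n) x y. *)
Lemma geometric_inv r n M : (0 < n < M)%N ->
  \sum_(k < r) (n%:R ^+ (k + 2))^-1 * (M%:R ^+ (r + 1 - k))^-1
  = ((n%:R ^+ r.+1)^-1 / M%:R - n%:R^-1 / M%:R ^+ r.+1) / (M - n)%:R :> R.
Proof.
move=> /andP[n0 nM]; have n0' : 0 < (n%:R : R) by rewrite ltr0n.
have M0 : 0 < (M%:R : R) by rewrite ltr0n (leq_trans _ nM).
have d0 : 0 < ((M - n)%:R : R) by rewrite ltr0n subn_gt0.
have ED : M%:R = n%:R + (M - n)%:R :> R by rewrite -natrD subnKC // ltnW.
set x := (n%:R : R)^-1; set y := (M%:R : R)^-1.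
have D : x - y = (M - n)%:R * x * y.
  rewrite /x /y ED; move: (n%:R : R) ((M - n)%:R : R) n0' d0 => u v u0 v0.
  by field; nonzero.
set G := \sum_(k < r) y ^+ (r.-1 - k) * x ^+ k.
have XX : y ^+ r - x ^+ r = (y - x) * G by rewrite subrXX.
have -> : \sum_(k < r) (n%:R ^+ (k + 2))^-1 * (M%:R ^+ (r + 1 - k))^-1
    = x ^+ 2 * y ^+ 2 * G.
  rewrite /G mulr_sumr; apply: eq_bigr => -[k /= kr] _.
  rewrite -!exprVn -/x -/y.
  have -> : (r + 1 - k = r.-1 - k + 2)%N by lia.
  by rewrite !exprD; ring.
rewrite -!exprVn -/x -/y !exprS.
have -> : x * x ^+ r * y - x * (y * y ^+ r) = (x - y) * x * y * G.
  have -> : x * x ^+ r * y - x * (y * y ^+ r) = - (y ^+ r - x ^+ r) * x * y by ring.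
  by rewrite XX; ring.
by rewrite D; move: ((M - n)%:R : R) d0 => v v0; field; nonzero.
Qed.

Lemma sum_inv_rev M :
  \sum_(1 <= n < M) ((M - n)%:R : R)^-1 = H M.-1.
Proof.
case: M => [|M]; first by rewrite harm0 big_geq.
rewrite big_nat_rev /= /harm; apply: eq_big_nat => n /andP[n0 nM].
by rewrite expr1; congr (_%:R^-1); lia.
Qed.

(** Each factor at M is its value at M - 1 plus a power of 1/M. The product of the powers gives the
    first term; the two mixed sums coincide under reversal of k and are evaluated by
    [geometric_inv]. The coefficient 4 is twice the 2 in the identity that the sum of 1/(n(M-n))
    over n < M is 2 H_{M-1} / M. *)
Lemma harm_conv_diff r M : (0 < M)%N ->
  \sum_(k < r) harm R (k + 2) M * harm R (r + 1 - k) M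
  - \sum_(k < r) harm R (k + 2) M.-1 * harm R (r + 1 - k) M.-1
  = r%:R * (M%:R ^+ r.+3)^-1
    + 2 * \sum_(1 <= n < M) (n%:R ^+ r.+1)^-1 / M%:R / (M - n)%:R
    - 4 * (H M.-1 / M%:R ^+ r.+2).
Proof.
move=> M0; have M0' : (M%:R : R) != 0 by rewrite pnatr_eq0 -lt0n.
pose h k := harm R k M.-1; pose y := (M%:R : R)^-1.
have hM k : harm R k M = h k + y ^+ k.
  by rewrite /h /y -{1}(prednK M0) harmS prednK // exprVn.
have sym : \sum_(k < r) y ^+ (k + 2) * h (r + 1 - k)%N
    = \sum_(k < r) h (k + 2)%N * y ^+ (r + 1 - k).
  rewrite (reindex_inj rev_ord_inj); apply: eq_bigr => -[k kr] _ /=.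
  by rewrite mulrC; congr (h _ * y ^+ _); lia.
have diag : \sum_(k < r) y ^+ (k + 2) * y ^+ (r + 1 - k) = r%:R * (M%:R ^+ r.+3)^-1.
  transitivity (\sum_(k < r) y ^+ r.+3).
    by apply: eq_bigr => -[k kr] _ /=; rewrite -exprD; congr (_ ^+ _); lia.
  by rewrite sumr_const card_ord -exprVn mulr_natl.
have cross : \sum_(k < r) h (k + 2)%N * y ^+ (r + 1 - k)
    = \sum_(1 <= n < M) (n%:R ^+ r.+1)^-1 / M%:R / (M - n)%:R
      - 2 * (H M.-1 / M%:R ^+ r.+2).
  under eq_bigr do rewrite /h /harm (prednK M0) mulr_suml.
  rewrite exchange_big /=.
  have -> : 2 * (H M.-1 / M%:R ^+ r.+2)
      = \sum_(1 <= n < M) (n%:R^-1 / M%:R ^+ r.+1) / (M - n)%:R.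
    have -> : 2 * (H M.-1 / M%:R ^+ r.+2) = (M%:R ^+ r.+2)^-1 * (H M.-1 + H M.-1).
      by ring.
    rewrite -[X in _ + X]sum_inv_rev {1}/harm prednK // -big_split /= mulr_sumr.
    apply: eq_big_nat => n /andP[n0 nM].
    have n0' : 0 < (n%:R : R) by rewrite ltr0n.
    have d0 : 0 < ((M - n)%:R : R) by rewrite ltr0n subn_gt0.
    have ED : M%:R = n%:R + (M - n)%:R :> R by rewrite -natrD subnKC // ltnW.
    have z0 : M%:R ^+ r.+1 != 0 :> R by rewrite expf_neq0.
    rewrite expr1 (exprS _ r.+1); move: (M%:R ^+ r.+1) z0 => z z0.
    rewrite ED; move: (n%:R : R) ((M - n)%:R : R) n0' d0 => u v u0 v0.
    by field; nonzero.
  rewrite -sumrB; apply: eq_big_nat => n nM.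
  rewrite -mulrBl -geometric_inv //; apply: eq_bigr => k _.
  by rewrite /y exprVn.
rewrite -sumrB.
under eq_bigr => k _ do rewrite !hM.
have -> : \sum_(k < r) ((h (k + 2)%N + y ^+ (k + 2)) * (h (r + 1 - k)%N + y ^+ (r + 1 - k))
      - h (k + 2)%N * h (r + 1 - k)%N)
    = \sum_(k < r) y ^+ (k + 2) * y ^+ (r + 1 - k)
      + \sum_(k < r) y ^+ (k + 2) * h (r + 1 - k)%N
      + \sum_(k < r) h (k + 2)%N * y ^+ (r + 1 - k).
  by rewrite -!big_split /=; apply: eq_bigr => k _; ring.
by rewrite sym diag cross; ring.
Qed.

(** Euler's formula. The products of zeta values are the limit of the same products of harmonic
    numbers up to M; summing the increments in M leaves r zeta(r+3) + 2 (E + zeta(r+3)) - 4 E, with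
    E the Euler sum. *)
Lemma euler_sumE r : 2 * euler_sum r.+2 = r.+2%:R * zeta R r.+3
  - \sum_(k < r) zeta R (k + 2) * zeta R (r + 1 - k).
Proof.
pose Q M := \sum_(k < r) harm R (k + 2) M * harm R (r + 1 - k) M.
have Qlim : sums_to (fun M => Q M - Q M.-1)
    (\sum_(k < r) zeta R (k + 2) * zeta R (r + 1 - k)).
  rewrite /sums_to -cvg_shiftS /=.
  have -> : (fun N => \sum_(1 <= M < N.+1) (Q M - Q M.-1)) = Q.
    apply/funext; elim=> [|N IH].
      by rewrite big_geq // /Q big1 // => k _; rewrite harm0 mul0r.
    by rewrite big_nat_recr //= IH addrC subrK.
  apply: cvg_big => [|[k /= kr] _]; first exact: add_continuous.
  by apply: cvgM; apply: harm_cvg; lia.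
(* The triangle n < M extended by zero, as the exchange of summations requires. Row n is then
   shifted by M = n + j, where 1/(j(j+n)) sums to H_n / n. *)
pose a n M : R := if (n < M)%N then (n%:R ^+ r.+1)^-1 / M%:R / (M - n)%:R else 0.
have T : sums_to (fun M => \sum_(1 <= n < M) (n%:R ^+ r.+1)^-1 / M%:R / (M - n)%:R)
    (euler_sum r.+2 + zeta R r.+3).
  apply: (@sums_to_swap _ a (fun n => H n / n%:R ^+ r.+2)) => [n M n0 M0|n n0||M M0].
  - by rewrite /a; case: ifP => // _; rewrite !divr_ge0 ?invr_ge0 ?exprn_ge0.
  - apply: (@sums_to_addn _ _ n) => [M /andP[_ Mn]|].
      by rewrite /a ltnNge Mn.
    have -> : H n / n%:R ^+ r.+2 = (n%:R ^+ r.+1)^-1 * (H n / n%:R).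
      by rewrite (exprS _ r.+1) invfM; ring.
    apply: eq_sums_to (sums_toZ (inv_mul_sums n n0)) => M M0.
    have nM : (n < M + n)%N by lia.
    by rewrite /a nM addnK (addnC M) invfM; ring.
  - exact: harm_pow_sumsE.
  - exact: (sums_to_finite (fun n => (n%:R ^+ r.+1)^-1 / M%:R / (M - n)%:R) M).
have S := sums_toB (sums_toD (sums_toZ (c := r%:R) (zeta_sums r.+3 isT))
  (sums_toZ (c := 2) T)) (sums_toZ (c := 4) (euler_sums r.+2 isT)).
have := sums_to_uniq (eq_sums_to _ S) Qlim.
move=> <-; last by move=> M M0; rewrite /Q harm_conv_diff.
by rewrite -[r.+2]addn2 natrD; ring.
Qed.

End EulerSums.

(** * Summation of the double series by partial fractions in n *)

Section PartialFractions.
Context {R : realType}.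
Implicit Types (i m n p q r N : nat).
Local Notation b n := (@binom_ratio R n).
Local Notation H n := (harm R 1 n).

Lemma inv_binomE p n (x : R) :
  4 ^+ n * x / (n%:R ^+ p * 'C(2 * n, n)%:R) = x / (n%:R ^+ p * b n).
Proof. by rewrite /binom_ratio mulrA [in RHS]invfM invrK; move: (_ ^-1) => A; ring. Qed.

(* Solution of [m * A (r+1) = E r - A r]: this is how
   [A r = \sum_n c_n / (n^r (n + m))] and its derivatives in [n] depend on [r],
   because [m / (n^(r+1) (n + m)) = 1 / n^(r+1) - 1 / (n^r (n + m))]. *)
Fixpoint pfrac (A0 : nat -> R) (E : nat -> R) r m : R :=
  if r is r'.+1 then (E r' - pfrac A0 E r' m) / m%:R else A0 m.

(** Each unrolling divides by m and changes the sign, so E meets the sum of b_m / m^(i+1) with sign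
    (-1)^i, a Taylor coefficient of f at 0. The induction carries an additional power m^l, since
    every division raises the exponent. *)
Lemma pfrac_sums (A0 E : nat -> R) (T : R) r :
  sums_to (fun m => b m * A0 m / m%:R ^+ r) T ->
  sums_to (fun m => b m * pfrac A0 E r m)
    (\sum_(i < r) conn_coef 0 i.+1 * E (r - i.+1)%N + (-1) ^+ r * T).
Proof.
have aux k l : sums_to (fun m => b m * A0 m / m%:R ^+ (l + k)) T ->
  sums_to (fun m => b m * pfrac A0 E k m / m%:R ^+ l)
    (\sum_(i < k) (-1) ^+ i * S_ R (l + i.+1) * E (k - i.+1)%N + (-1) ^+ k * T).
  elim: k l => [|k IH] l hT.
    by rewrite addn0 in hT; rewrite big_ord0 add0r mul1r.
  have hT' : sums_to (fun m => b m * A0 m / m%:R ^+ (l.+1 + k)) T.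
    by rewrite addSnnS.
  have := sums_toB (sums_toZ (c := E k) (binom_sums l.+1 isT)) (IH l.+1 hT').
  set s := _ - _; set s' := _ + _.
  have -> : s = s'.
    rewrite /s /s' big_ord_recl /= expr0 mul1r subn1 /= addn1 exprS.
    have -> : \sum_(i < k) (-1) ^+ bump 0 i * S_ R (l + (bump 0 i).+1)
          * E (k.+1 - (bump 0 i).+1)%N
        = - \sum_(i < k) (-1) ^+ i * S_ R (l.+1 + i.+1) * E (k - i.+1)%N.
      rewrite -sumrN; apply: eq_bigr => i _.
      by rewrite /bump /= add1n exprS subSS -addSnnS; ring.
    by ring.
  apply: eq_sums_to => m m0 /=.
  have m0' : (m%:R : R) != 0 by rewrite pnatr_eq0 -lt0n.
  have ml : m%:R ^+ l != 0 :> R by rewrite expf_neq0.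
  rewrite exprS.
  by field; nonzero.
move=> hT; have := aux r 0 hT.
have -> : \sum_(i < r) (-1) ^+ i * S_ R (0 + i.+1) * E (r - i.+1)%N
    = \sum_(i < r) conn_coef 0 i.+1 * E (r - i.+1)%N.
  by apply: eq_bigr => i _; rewrite conn_coef0S.
by apply: eq_sums_to => m m0; rewrite expr0 divr1.
Qed.

Lemma harm_pfrac_sums r m : (0 < m)%N ->
  sums_to (fun n => H n.-1 / (n%:R ^+ r.+1 * (n + m)%:R))
    (pfrac (fun m => (H m ^+ 2 + harm R 2 m) / (2 * m%:R))
       (fun r => euler_sum r.+2) r m).
Proof.
move=> m0; have m0' : 0 < (m%:R : R) by rewrite ltr0n.
elim: r => [|r IH] /=.
  have -> : (H m ^+ 2 + harm R 2 m) / (2 * m%:R)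
      = m%:R^-1 * ((H m ^+ 2 + harm R 2 m) / 2) by field; nonzero.
  apply: eq_sums_to (sums_toZ (harm_diff_inv_sums m)) => n n0.
  have n0' : 0 < (n%:R : R) by rewrite ltr0n.
  rewrite natrD expr1; move: (n%:R : R) (m%:R : R) n0' m0' => x y x0 y0.
  by field; nonzero.
rewrite mulrC.
apply: eq_sums_to (sums_toZ (sums_toB (euler_sums r.+2 isT) IH)) => n n0.
have n0' : 0 < (n%:R : R) by rewrite ltr0n.
have n1 : n%:R ^+ r.+1 != 0 :> R by rewrite expf_neq0 // lt0r_neq0.
rewrite (exprS _ r.+1) natrD; move: (n%:R ^+ r.+1 : R) n1 => z z0.
by move: (n%:R : R) (m%:R : R) n0' m0' => x y x0 y0; field; nonzero.
Qed.

(** The summand is minus the derivative in n of 1 / (n^r (n+m)), and (r+1) / n^(r+2) is that of 1 /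
    n^(r+1), so the partial fraction recursion holds in differentiated form. *)
Lemma inv_sqr_pfrac_sums r m : (0 < m)%N ->
  sums_to (fun n => r%:R / (n%:R ^+ r.+1 * (n + m)%:R)
      + (n%:R ^+ r * (n + m)%:R ^+ 2)^-1)
    (pfrac (fun m => zeta R 2 - harm R 2 m)
       (fun r => r.+1%:R * zeta R r.+2) r m).
Proof.
move=> m0; have m0' : 0 < (m%:R : R) by rewrite ltr0n.
elim: r => [|r IH] /=.
  apply: eq_sums_to (inv_sqr_shift_sums m) => n n0.
  by rewrite mul0r add0r expr0 mul1r.
rewrite [(_ - _) / m%:R]mulrC.
have h := sums_toZ (c := r.+1%:R) (zeta_sums (R := R) r.+2 isT).
apply: eq_sums_to (sums_toZ (sums_toB h IH)) => n n0.
have n0' : 0 < (n%:R : R) by rewrite ltr0n.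
have n1 : n%:R ^+ r != 0 :> R by rewrite expf_neq0 // lt0r_neq0.
rewrite !(exprS _ r.+1) !(exprS _ r) natrD -natr1.
move: (n%:R ^+ r : R) n1 (r%:R : R) => z z0 t.
by move: (n%:R : R) (m%:R : R) n0' m0' => x y x0 y0; field; nonzero.
Qed.

Lemma binom_div_sums n : (0 < n)%N ->
  sums_to (fun m => b m / (n + m)%:R) (((b n)^-1 - 1) / n%:R).
Proof.
move=> n0; have n0' : 0 < (n%:R : R) by rewrite ltr0n.
rewrite mulrC; apply: eq_sums_to (sums_toZ (inv_binom_ratio_sums n)) => m m0.
have m0' : 0 < (m%:R : R) by rewrite ltr0n.
rewrite addnC natrD; move: (b m) (n%:R : R) (m%:R : R) n0' m0'.
by move=> z x y x0 y0; field; nonzero.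
Qed.

Lemma binom_div_sqr_sums n : (0 < n)%N ->
  sums_to (fun m => b m / (n + m)%:R ^+ 2)
    ((((b n)^-1 - 1) / n%:R - bconn 1 n) / n%:R).
Proof.
move=> n0; have n0' : 0 < (n%:R : R) by rewrite ltr0n.
have := sums_toZ (c := n%:R^-1) (sums_toB (binom_div_sums n n0) (bconn_sums 1 n isT)).
rewrite mulrC; apply: eq_sums_to => m m0.
have m0' : 0 < (m%:R : R) by rewrite ltr0n.
rewrite addnC natrD; move: (n%:R : R) (m%:R : R) n0' m0' => x y x0 y0.
by field; nonzero.
Qed.

Lemma inv_binom_pow_sums p : (2 <= p)%N ->
  sums_to (fun n => (n%:R ^+ p * b n)^-1) (S_tilde R p).
Proof.
move=> p2.
suff [l hl] : exists l : R, sums_to (fun n => (n%:R ^+ p * b n)^-1) l.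
  by rewrite /S_tilde (_ : sum_ge1 _ = l) //; apply: sum_ge1E;
     apply: eq_sums_to hl => n _; rewrite -[4 ^+ n]mulr1 inv_binomE mul1r.
(* The bound 1 / b_n <= 2 n only yields the divergent harmonic series here; the case p = 2 is
   instead obtained by expanding 1 / b_n - 1 over m and exchanging summations. *)
have h2 : exists l : R, sums_to (fun n => (n%:R ^+ 2 * b n)^-1) l.
  pose u m : R := b m * (H m / m%:R).
  have hu : sums_to u (sum_ge1 u).
    apply: (sums_to_le _ (binom_harm_sums 1 isT)) => m m0.
    rewrite /u expr1 mulrA mulr_ge0 ?binom_ratio_ge0 ?invr_ge0 ?harm_ge0 //=.
      have h1 := harm_ge1 (R := R) 1 m m0.
      rewrite ler_wpM2r ?invr_ge0 // mulrC ler_wpM2r ?binom_ratio_ge0 //.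
      by rewrite expr2 ler_peMl // (le_trans _ h1).
    by rewrite mulr_ge0 ?binom_ratio_ge0 ?harm_ge0.
  pose a m n : R := b m / (n%:R * (n + m)%:R).
  have : sums_to (fun n => ((b n)^-1 - 1) / n%:R ^+ 2) (sum_ge1 u).
    apply: (@sums_to_swap _ a u) => [m n m0 n0|m m0||n n0].
    - by rewrite /a divr_ge0 ?binom_ratio_ge0 ?mulr_ge0.
    - exact: sums_toZ (inv_mul_sums m m0).
    - exact: hu.
    - have := sums_toZ (c := n%:R^-1) (binom_div_sums n n0).
      have -> : n%:R^-1 * (((b n)^-1 - 1) / n%:R) = ((b n)^-1 - 1) / n%:R ^+ 2.
        by move: (b n)^-1 => B; rewrite expr2 invfM; ring.
      by apply: eq_sums_to => m _; rewrite /a invfM; ring.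
  move=> /(sums_toD (zeta_sums 2 isT)) h; exists (zeta R 2 + sum_ge1 u).
  apply: eq_sums_to h => n _.
  by rewrite (invfM _ (b n)) mulrBl mul1r addrC subrK mulrC.
case: h2 => l /sums_to_le hl; eexists; apply: hl => n n0.
have bn := binom_ratio_gt0 (R := R) n.
have n1 : 1 <= (n%:R : R) by rewrite ler1n.
have np k : 0 < n%:R ^+ k * b n by rewrite mulr_gt0 // exprn_gt0 // ltr0n.
rewrite invr_ge0 ltW //= lef_pV2 ?posrE //.
by rewrite ler_wpM2r ?binom_ratio_ge0 // ler_weXn2l.
Qed.

(** H_{n-1} times f(n) - 1 gives the double series in (n, m). The constant 1 in f restores the plain
    Euler sum, which is the term i = 0. *)
Lemma harm_pred_inv_binom_sums r :
  sums_to (fun n => H n.-1 / (n%:R ^+ r.+2 * b n))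
    (\sum_(i < r.+1) conn_coef 0 i * euler_sum (r.+2 - i)
     + (-1) ^+ r / 2 * (S_11 R r.+1 + S_2 R r.+1)).
Proof.
pose A0 m : R := (H m ^+ 2 + harm R 2 m) / (2 * m%:R).
have hT : sums_to (fun m => b m * A0 m / m%:R ^+ r)
    (2^-1 * (S_11 R r.+1 + S_2 R r.+1)).
  have h := sums_toD (binom_harm_sums (R := R) r.+1 isT) (binom_harm2_sums r.+1 isT).
  apply: eq_sums_to (sums_toZ h) => m m0.
  have m0' : (m%:R : R) != 0 by rewrite pnatr_eq0 -lt0n.
  have m1 : m%:R ^+ r != 0 :> R by rewrite expf_neq0.
  rewrite /A0 (exprS _ r); move: (b m) => B.
  by field; nonzero.
have := pfrac_sums A0 (fun r => euler_sum r.+2) _ r hT.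
set S := (X in sums_to _ X) => hA.
pose a m n := b m * (H n.-1 / (n%:R ^+ r.+1 * (n + m)%:R)).
have h : sums_to (fun n => H n.-1 / n%:R ^+ r.+2 * ((b n)^-1 - 1)) S.
  apply: (@sums_to_swap _ a _ _ _ _ _ hA) => [m n m0 n0|m m0|n n0].
  - by rewrite mulr_ge0 ?binom_ratio_ge0 // divr_ge0 ?harm_ge0 // mulr_ge0 ?exprn_ge0.
  - exact: sums_toZ (harm_pfrac_sums r m m0).
  - have := sums_toZ (c := H n.-1 / n%:R ^+ r.+1) (binom_div_sums n n0).
    have -> : H n.-1 / n%:R ^+ r.+1 * (((b n)^-1 - 1) / n%:R)
        = H n.-1 / n%:R ^+ r.+2 * ((b n)^-1 - 1).
      by move: (b n)^-1 => B; rewrite (exprS _ r.+1) invfM; ring.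
    by apply: eq_sums_to => m _; rewrite /a invfM; ring.
have := sums_toD (euler_sums r.+2 isT) h.
rewrite big_ord_recl conn_coef00 mul1r subn0.
have -> : \sum_(i < r) conn_coef 0 (bump 0 i) * euler_sum (r.+2 - bump 0 i)
    = \sum_(i < r) conn_coef 0 i.+1 * euler_sum (r - i.+1).+2 :> R.
  apply: eq_bigr => -[i ir] _ /=; rewrite /bump /= add1n.
  by congr (_ * euler_sum _); lia.
set s := _ + _; set s' := _ + _; have -> : s = s' by rewrite /s /s' /S; ring.
apply: eq_sums_to => n _.
by rewrite (invfM _ (b n)); move: (b n)^-1 => B; ring.
Qed.

(** The summand is minus the derivative of f(x) / x^q at x = n, because [bconn 1 n] is f'(n). In the
    proof the local [q] is one less, and the constant 1 in f supplies the term i = 0 of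
    [sumG_linear]. *)
Lemma bconn_inv_binom_sums q : (2 <= q)%N ->
  sums_to (fun n => q%:R / (n%:R ^+ q.+1 * b n) - bconn 1 n / n%:R ^+ q)
    (sumG_linear R q + (-1) ^+ q * (S_2 R q.-1 - zeta R 2 * S_ R q.-1)).
Proof.
case: q => [|[|r]] // _; set q := r.+1.
have hT : sums_to (fun m => b m * (zeta R 2 - harm R 2 m) / m%:R ^+ q)
    (zeta R 2 * S_ R q - S_2 R q).
  have h := sums_toZ (c := zeta R 2) (binom_sums q isT).
  by apply: eq_sums_to (sums_toB h (binom_harm2_sums q isT)) => m m0; ring.
have := pfrac_sums _ (fun r => r.+1%:R * zeta R r.+2) _ q hT.
set S := (X in sums_to _ X) => hA.
pose a m n : R := b m * (q%:R / (n%:R ^+ q.+1 * (n + m)%:R)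
      + (n%:R ^+ q * (n + m)%:R ^+ 2)^-1).
pose c n : R := q.+1%:R * ((b n)^-1 - 1) / n%:R ^+ q.+2 - bconn 1 n / n%:R ^+ q.+1.
have h : sums_to c S.
  apply: (@sums_to_swap _ a _ _ _ _ _ hA) => [m n m0 n0|m m0|n n0].
  - apply: mulr_ge0; first exact: binom_ratio_ge0.
    apply: addr_ge0; first by apply: divr_ge0 => //; apply: mulr_ge0.
    by rewrite invr_ge0; apply: mulr_ge0; apply: exprn_ge0.
  - exact: sums_toZ (inv_sqr_pfrac_sums q m m0).
  - have n0' : (n%:R : R) != 0 by rewrite pnatr_eq0 -lt0n.
    have h1 := sums_toZ (c := q%:R / n%:R ^+ q.+1) (binom_div_sums n n0).
    have h2 := sums_toZ (c := (n%:R ^+ q)^-1) (binom_div_sqr_sums n n0).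
    have := sums_toD h1 h2; set l := _ + _; have -> : l = c n.
      rewrite /l /c (exprS _ q.+1) (exprS _ q) -natr1.
      have bn : b n != 0 by rewrite lt0r_neq0 // binom_ratio_gt0.
      move: (n%:R : R) n0' (b n) bn => y y0 z z0.
      have yq : y ^+ q != 0 by rewrite expf_neq0.
      by field; nonzero.
    by apply: eq_sums_to => m _; rewrite /a !invfM; ring.
have := sums_toD (sums_toZ (c := q.+1%:R) (zeta_sums (R := R) q.+2 isT)) h.
rewrite sumG_linearE // big_ord_recl conn_coef00 mul1r subn0.
have -> : \sum_(i < q) conn_coef 0 (bump 0 i)
      * ((q.+1 - bump 0 i)%:R * zeta R (q.+1 - bump 0 i).+1)
    = \sum_(i < q) conn_coef 0 i.+1 * ((q - i.+1).+1%:R * zeta R (q - i.+1).+2).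
  apply: eq_bigr => -[i iq] _ /=; rewrite /bump /= add1n.
  by have -> : (q.+1 - i.+1 = (q - i.+1).+1)%N by lia.
set s := _ + _; set s' := _ + _; have -> : s = s'.
  by rewrite /s /s' /S /= (exprS _ q); ring.
apply: eq_sums_to => n _.
by rewrite /c (invfM _ (b n)); move: (b n)^-1 => B; ring.
Qed.

(** Divided by f, the recurrence for f' says that f'/f at N + 1 is f'/f at N plus 1/(N+1) -
    1/(N+1/2). Summed from 0, where the value is S_1 = 2 ln 2, this produces the harmonic
    numbers. *)
Lemma bconn1E N :
  bconn 1 N = (2 * H N - 2 * H (2 * N) + 2 * ln 2) / b N.
Proof.
elim: N => [|N IH].
  by rewrite muln0 harm0 binom_ratio0 bconn0 // S_1E; field.
have := bconn_rec1 (R := R) N; rewrite IH => E.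
have N0 := ler0n R N.
have h0 : N%:R + 1 / 2 != 0 :> R by exact: half_neq0.
apply: (mulfI h0); move/(canRL (addrK _)): E => ->.
have -> : (2 * N.+1 = (2 * N).+2)%N by lia.
rewrite !harmS !expr1 binom_ratioS.
have -> : (2 * N).+2%:R = 2 * (N%:R + 1) :> R.
  by rewrite natr1 -natrM; congr (_%:R); lia.
have -> : (2 * N).+1%:R = 2 * N%:R + 1 :> R by rewrite -natr1 natrM.
have bN := binom_ratio_gt0 (R := R) N.
rewrite -natr1; move: (b N) bN (H N) (H (2 * N)) => x x0 y z.
by field; nonzero.
Qed.

End PartialFractions.

(** [sumG_linear] has one more term, i = r + 1, which would correspond to the divergent sum of
    H_{n-1} / n and so is absent on the left. It is the product of zeta(2) and S_{r+1}; the matching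
    inner sum of [sumG_quadratic] is empty. *)
Lemma sum_conn_euler (R : realType) r :
  2 * \sum_(i < r.+1) conn_coef 0 i * euler_sum (r.+2 - i)
  = sumG_linear R r.+2 - sumG_quadratic R r.+2 - (-1) ^+ r * S_ R r.+1 * zeta R 2.
Proof.
rewrite sumG_linearE // sumG_quadraticE // 2!(big_ord_recr r.+1) /= subSnn big_ord0.
rewrite mulr0 addr0 -/(conn_coef 0 r.+1) conn_coef0S mul1r.
transitivity (\sum_(i < r.+1) (conn_coef 0 i * ((r.+2 - i)%:R * zeta R (r.+2 - i).+1)
  - conn_coef 0 i * \sum_(k < r.+2 - i - 2)
      zeta R (k + 2) * zeta R (r.+2 - i - 2 + 1 - k))).
  rewrite mulr_sumr; apply: eq_bigr => -[i ir] _ /=.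
  have E := euler_sumE (R := R) (r.+2 - i - 2).
  have ri : ((r.+2 - i - 2).+2 = r.+2 - i)%N by lia.
  by rewrite ri in E; rewrite mulrCA E mulrBr.
by rewrite sumrB; ring.
Qed.

Theorem theorem3p6 (R : realType) (q : nat) (hq : (2 <= q)%N) :
  sums_to (fun n => 4 ^+ n * harm R 1 n / (n%:R ^+ q * 'C(2 * n, n)%:R))
    (S_tilde R q.+1
     + (-1) ^+ q / 2 * (S_11 R q.-1 - zeta R 2 * S_ R q.-1 + S_2 R q.-1)
     + 1 / 2 * sumG_linear R q
     - 1 / 2 * sumG_quadratic R q)
  /\
  sums_to (fun n => 4 ^+ n * harm R 1 (2 * n) / (n%:R ^+ q * 'C(2 * n, n)%:R))
    ((1 - q%:R / 2) * S_tilde R q.+1 + ln 2 * S_tilde R q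
     + (-1) ^+ q / 2
       * (S_11 R q.-1 - 2 * zeta R 2 * S_ R q.-1 + 2 * S_2 R q.-1)
     + sumG_linear R q
     - 1 / 2 * sumG_quadratic R q).
Proof.
case: q hq => [|[|r]] // _; set q := r.+2.
have h0 := inv_binom_pow_sums (R := R) q isT.
have h1 := inv_binom_pow_sums (R := R) q.+1 isT.
have h2 := harm_pred_inv_binom_sums (R := R) r; rewrite -/q in h2.
have E := sum_conn_euler R r; rewrite -/q in E.
have hH : sums_to (fun n => harm R 1 n / (n%:R ^+ q * binom_ratio n))
    (S_tilde R q.+1
     + (-1) ^+ q / 2 * (S_11 R q.-1 - zeta R 2 * S_ R q.-1 + S_2 R q.-1)
     + 1 / 2 * sumG_linear R q - 1 / 2 * sumG_quadratic R q).
  have := sums_toD h1 h2; set s := _ + _; set s' := (X in _ -> sums_to _ X).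
  have -> : s = s'.
    rewrite /s /s' /= -[\sum_(_ < _) _](mulKf (_ : 2 != 0 :> R)) // E !exprS.
    by field.
  apply: eq_sums_to => n n0; rewrite (harm_pred n) // mulrDl addrC.
  have n0' : (n%:R : R) != 0 by rewrite pnatr_eq0 -lt0n.
  have b0 : binom_ratio n != 0 :> R by rewrite lt0r_neq0 // binom_ratio_gt0.
  rewrite (exprS _ q); move: (n%:R : R) n0' (binom_ratio n : R) b0 => y y0 z z0.
  have yq : y ^+ q != 0 by rewrite expf_neq0.
  by field; nonzero.
split.
  by apply: eq_sums_to hH => n _; rewrite inv_binomE.
have h3 := bconn_inv_binom_sums (R := R) q isT.
(* By the formula for f', H_{2n} f(n) = H_n f(n) + ln 2 f(n) - f'(n) / 2. Half of [h3] contributes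
   the last term together with an excess of q/2 times f(n) / n^(q+1), which is subtracted again. *)
have := sums_toD (sums_toD hH (sums_toZ (c := ln 2) h0))
  (sums_toB (sums_toZ (c := 1 / 2) h3) (sums_toZ (c := q%:R / 2) h1)).
set s := _ + _; set s' := (X in _ -> sums_to _ X).
have -> : s = s' by rewrite /s /s'; field.
apply: eq_sums_to => n n0; rewrite inv_binomE bconn1E.
have n0' : (n%:R : R) != 0 by rewrite pnatr_eq0 -lt0n.
have b0 : binom_ratio n != 0 :> R by rewrite lt0r_neq0 // binom_ratio_gt0.
rewrite (exprS _ q); move: (n%:R : R) n0' (binom_ratio n : R) b0 => y y0 z z0.
have yq : y ^+ q != 0 by rewrite expf_neq0.
by field; nonzero.
Qed.
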